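(* Let $p$ be a prime and let $K/F$ be a cyclic Galois extension of local fields of degree $p^n$, $n\ge 1$, with $\operatorname{char}F\neq p$ and with $F$ containing a primitive $p$th root of unity. Then $m(K/F)\in\{-\infty,0\}$.
   Context: Let $p$ be a prime and $K/F$ a cyclic Galois extension of degree $p^n$, $n\ge 1$, with $\operatorname{char}F\ne p$ and $F$ containing a primitive $p$th root of unity $\xi_p$. For $0\le i\le n$ let $K_i$ be the unique intermediate field $F\subseteq K_i\subseteq K$ with $[K_i:F]=p^i$. Define $$m(K/F)=\begin{cases}-\infty, & \xi_p\in N_{K/F}(K^\times),\\ \min\{s\in\{0,\dots,n\} : \xi_p\in N_{K/K_s}(K^\times)\}-1, & \xi_p\notin N_{K/F}(K^\times).\end{cases}$$ Here $N_{K/K_s}$ denotes the field norm. *)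

(* Defs.v *)
From HB Require Import structures.
From mathcomp Require Import all_boot all_order all_algebra all_fingroup.
From mathcomp Require Import all_solvable all_field.
From mathcomp Require Import all_classical all_reals all_analysis.

Set Implicit Arguments.
Unset Strict Implicit.
Unset Printing Implicit Defensive.

Import Order.TTheory GRing.Theory Num.Theory.

Local Open Scope classical_set_scope.
Local Open Scope ring_scope.

Record absolute_value (R : realType) (F : fieldType) := AbsoluteValue {
  absval :> F -> R;
  absval_ge0 : forall x, 0 <= absval x;
  absval_eq0 : forall x, absval x = 0 -> x = 0;
  absvalM : {morph absval : x y / x * y};
  absvalD : forall x y, absval (x + y) <= absval x + absval y;
  absval_nontrivial : exists2 x, x != 0 & absval x != 1
}.

Section AbsoluteValueTheory.
Variables (R : realType) (F : fieldType) (a : absolute_value R F).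

Lemma absval1 : a 1 = 1.
Proof.
have a1n0 : a 1 != 0.
  by apply/eqP => /absval_eq0 /eqP; rewrite oner_eq0.
by apply: (mulfI a1n0); rewrite -absvalM !mulr1.
Qed.

Lemma absval0 : a 0 = 0.
Proof.
have [x x0 ax1] := absval_nontrivial a.
apply/eqP; apply: contraNT ax1 => a0n0; apply/eqP.
by apply: (mulfI a0n0); rewrite -absvalM mul0r mulr1.
Qed.

Lemma absvalN x : a (- x) = a x.
Proof.
have aN1 : a (-1) = 1.
  apply/eqP; rewrite -(@eqrXn2 _ 2) ?absval_ge0 //.
  by rewrite expr2 -absvalM mulrNN mulr1 absval1 expr1n.
by rewrite -mulN1r absvalM aN1 mul1r.
Qed.

End AbsoluteValueTheory.

(* A copy of F carrying the topology of the metric a (x - y). The library's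
   normed structures are not applicable: they require `|x *+ n| = `|x| *+ n. *)
Definition valued (R : realType) (F : fieldType)
  (a : absolute_value R F) : Type := F.

Section ValuedTopology.
Variables (R : realType) (F : fieldType) (a : absolute_value R F).

HB.instance Definition _ := Choice.copy (valued a) F.

Let vball (x : valued a) (e : R) : set (valued a) :=
  [set y | a ((x : F) - (y : F)) < e].
Let vent : set_system (valued a * valued a) := entourage_ vball.
Let vnbhs (x : valued a) : set_system (valued a) := nbhs_ vent x.

HB.instance Definition _ := hasNbhs.Build (valued a) vnbhs.

Let vball_center x (e : R) : 0 < e -> vball x e x.
Proof. by rewrite /vball /= subrr absval0. Qed.

Let vball_sym x y (e : R) : vball x e y -> vball y e x.
Proof. by rewrite /vball /= -absvalN opprB. Qed.

Let vball_triangle x y z (e1 e2 : R) :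
  vball x e1 y -> vball y e2 z -> vball x (e1 + e2) z.
Proof.
rewrite /vball /= => xy yz.
rewrite -(subrKA (y : F)); apply: le_lt_trans (absvalD _ _ _) _.
exact: ltrD.
Qed.

HB.instance Definition _ := @Nbhs_isPseudoMetric.Build R (valued a)
  vent erefl vball vball_center vball_sym vball_triangle erefl.

End ValuedTopology.

(* Since absolute values are nontrivial here, the topology is never discrete.
   The archimedean local fields are included. *)
Definition local_field (R : realType) (F : fieldType)
    (a : absolute_value R F) : Prop :=
  locally_compact [set: valued a].

Section NormInvariant.
Variables (F : fieldType) (K : splittingFieldType F).

(* The intermediate field of degree d over F, meaningful when it exists and is
   unique; see intermediate_fieldP. *)
Definition intermediate_field (d : nat) : {subfield K} :=
  xget {:K}%AS [set E : {subfield K} | \dim E = d].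

Lemma intermediate_fieldP (p n i : nat) (E : {subfield K}) :
    prime p -> galois 1%AS {:K} -> cyclic 'Gal({:K} / 1%AS) ->
    \dim {:K} = (p ^ n)%N -> (i <= n)%N ->
  \dim E = (p ^ i)%N <-> E = intermediate_field (p ^ i).
Proof.
move=> p_pr galK cycK dimK le_in.
have p_gt0 := prime_gt0 p_pr.
have galE (L : {subfield K}) : galois L {:K}.
  by apply: galoisS galK; rewrite sub1v subvf.
have dimG (L : {subfield K}) : (#|'Gal({:K} / L)%g| * \dim L = p ^ n)%N.
  by rewrite -(galois_dim (galE L)) -dimK divnK // field_dimS // subvf.
have dim_uniq (L M : {subfield K}) : \dim L = \dim M -> L = M.
  move=> eqd; have /eqP eqc : #|'Gal({:K} / L)%g| == #|'Gal({:K} / M)%g|.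
    by rewrite -(eqn_pmul2r (adim_gt0 M)) -{1}eqd !dimG.
  have /eqP eqG : 'Gal({:K} / L)%g == 'Gal({:K} / M)%g.
    by rewrite (eq_subG_cyclic cycK) ?galS ?sub1v //; apply/eqP.
  apply: val_inj; rewrite /= -(galois_fixedField (galE L)) eqG.
  exact: (galois_fixedField (galE M)).
have dim_layer : \dim (intermediate_field (p ^ i)) = (p ^ i)%N.
  rewrite /intermediate_field; case: xgetP => [//|noE].
  have oG : #|'Gal({:K} / 1%AS)%g| = (p ^ n)%N.
    by have := dimG 1%AS; rewrite dimv1 muln1.
  have /cyclicP[x Gx] := cycK.
  have ox : #[x]%g = (p ^ n)%N by rewrite orderE -Gx.
  pose H := <[(x ^+ (p ^ i))%g]>%G.
  have oH : #|H| = (p ^ (n - i))%N.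
    by rewrite -orderE orderXdiv ox ?dvdn_exp2l // expnB.
  case: (noE [aspace of fixedField H]); rewrite /=.
  apply/eqP; rewrite -(eqn_pmul2l (_ : 0 < p ^ (n - i))%N) ?expn_gt0 ?p_gt0 //.
  have := dimG [aspace of fixedField H].
  rewrite /= gal_fixedField oH => ->.
  by rewrite -expnD subnK.
by split=> [dimE|->//]; apply: dim_uniq; rewrite dimE dim_layer.
Qed.

(* The image of the nonzero elements of K under N_{K/E}; only used when K/E is Galois. *)
Definition norm_group (E : {subfield K}) : set K :=
  [set galNorm E {:K} x | x in [set x : K | x != 0]].

(* The invariant m(K/F) of a cyclic extension of degree p ^ n. The minimum is
   over a nonempty set: xi is its own norm for s = n, where K_n = K. *)
Definition m_invariant (p n : nat) (xi : F) : \bar int :=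
  let xi_norm (s : 'I_n.+1) :=
    `[< norm_group (intermediate_field (p ^ s)) xi%:A >] in
  if xi_norm ord0 then -oo%E
  else
    let s_min : 'I_n.+1 := [arg min_(s < ord_max | xi_norm s) s]%N in
    (s_min%:Z - 1)%:E.

End NormInvariant.

(* Main.v *)
(** Let sigma generate Gal(K/F), let M be the fixed field of sigma^p, and put
    q = p^n = [K : F], t = p^(n-1) = [K : M]. It suffices to show that xi is a
    norm from K to M.

    In the nonarchimedean case a Herbrand quotient computation gives
    [F^x : N(K^x)] = q and [M^x : N(K^x)] = t. These indices force some g in F^x
    not to be a norm from M, and then, by Hilbert 90, g^t is not a norm from K.
    Hence F^x/N(K^x) is cyclic of order q, generated by g, and its p-torsion element
    xi is of the form g^(t l) N_{K/F}(z), which is the norm of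
    g^l z sigma(z) ... sigma^(p-1)(z) from K to M.

    The Herbrand quotient of K^x is that of c^Z V, a subgroup of finite index, with
    c in F of absolute value > 1 and V a small ball around 1 for the sup norm
    attached to a normal basis. In the additive group of K balls are induced modules,
    and V inherits the vanishing of cohomology by successive approximation.

    In the archimedean case, if n >= 2, every element of the fixed field of
    sigma^(q/p) is a p-th power there up to sign, which contradicts Kummer theory. *)

From HB Require Import structures.
Require Import Defs.
From mathcomp Require Import all_boot all_order all_algebra all_fingroup.
From mathcomp Require Import all_solvable all_field.
From mathcomp Require Import all_classical all_reals all_analysis.
From mathcomp Require Import ring lra zify.

Set Implicit Arguments.
Unset Strict Implicit.
Unset Printing Implicit Defensive.

Import Order.TTheory GRing.Theory Num.Theory.
Local Open Scope classical_set_scope.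
Local Open Scope ring_scope.

(** * Absolute values *)

(** If [xi] is a norm from K to M, the minimum defining m is at most 1, which is all that is
    claimed. Invariance of [aK] under the Galois group is never assumed. In the nonarchimedean case
    the sup norm of a normal basis replaces it: the group permutes coordinates, so balls around 1
    are stable, at the price of a constant [D] in the bound for products. In the archimedean case
    boundedness of linear maps suffices. The normal basis comes from the separability of X^q - 1,
    which is where the characteristic assumption is used. Successive approximation, unlike a
    logarithm, works alike in every characteristic. Since V is cohomologically trivial, only c^Z
    contributes: its H^0 is cyclic of order q, its H^-1 is 0, and Hilbert 90 for K^x turns the
    quotient q into an index. No reciprocity map occurs, only counting: were all of F^x norms from
    M, the norm would map M^x/N(K^x) onto F^x/N(K^x), giving q <= t. *)

Section AbsoluteValue.
Variables (R : realType) (F : fieldType) (a : absolute_value R F).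
Implicit Types x y : F.

Lemma absval_gt0 x : x != 0 -> 0 < a x.
Proof.
move=> x0; rewrite lt_def absval_ge0 andbT.
by apply: contra_neq x0 => /absval_eq0.
Qed.

Lemma absvalV x : a x^-1 = (a x)^-1.
Proof.
have [->|x0] := eqVneq x 0; first by rewrite invr0 absval0 invr0.
have ax0 : a x != 0 by rewrite gt_eqF // absval_gt0.
by apply: (mulfI ax0); rewrite -absvalM !divff // absval1.
Qed.

Lemma absval_div x y : a (x / y) = a x / a y.
Proof. by rewrite absvalM absvalV. Qed.

Lemma absvalX x k : a (x ^+ k) = a x ^+ k.
Proof. by elim: k => [|k IH]; rewrite ?expr0 ?absval1 // !exprS absvalM IH. Qed.

Lemma absval_distC x y : a (x - y) = a (y - x).
Proof. by rewrite -absvalN opprB. Qed.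

Lemma absval_sum (I : Type) (s : seq I) (P : pred I) (f : I -> F) :
  a (\sum_(i <- s | P i) f i) <= \sum_(i <- s | P i) a (f i).
Proof.
elim/big_rec2: _ => [|i u v _ le_vu]; first by rewrite absval0.
by apply: le_trans (absvalD _ _ _) _; rewrite lerD2l.
Qed.

Lemma absval_nat k : a k%:R <= k%:R.
Proof.
elim: k => [|k IH]; first by rewrite absval0.
rewrite -natr1; apply: le_trans (absvalD _ _ _) _.
by rewrite absval1 -natr1 lerD2r.
Qed.

Lemma absval_gt1 : exists2 c, c != 0 & 1 < a c.
Proof.
have [x x0 ax1] := absval_nontrivial a.
have [lt1|gt1|/eqP] := ltgtP 1 (a x).
- by exists x.
- by exists x^-1; rewrite ?invr_eq0 // absvalV invf_gt1 ?absval_gt0.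
- by rewrite eq_sym (negPf ax1).
Qed.

End AbsoluteValue.

Lemma bernoulli (R : realType) (x : R) (k : nat) :
  1 <= x -> 1 + k%:R * (x - 1) <= x ^+ k.
Proof.
move=> x1; elim: k => [|k IH]; first by rewrite mul0r addr0.
have x0 : 0 <= x by lra.
rewrite exprS; apply: le_trans (ler_wpM2l x0 IH); rewrite -natr1.
have -> : 1 + (k%:R + 1) * (x - 1) = x * (1 + k%:R * (x - 1)) - k%:R * (x - 1) ^+ 2.
  by ring.
by rewrite lerBlDr lerDl mulr_ge0 ?ler0n ?sqr_ge0.
Qed.

Lemma exp_unbounded (R : realType) (x B : R) : 1 < x -> exists k, B < x ^+ k.
Proof.
move=> x1; pose k := (Num.truncn (`|B| / (x - 1))).+1.
exists k; apply: lt_le_trans (bernoulli k (ltW x1)).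
suff : B < k%:R * (x - 1) by lra.
rewrite -ltr_pdivrMr ?subr_gt0 //.
apply: le_lt_trans (truncnS_gt _).
by rewrite ler_pM2r ?invr_gt0 ?subr_gt0 // ler_norm.
Qed.

(* Squaring the Bernoulli inequality beats the linear bound. *)
Lemma exp_linear_le1 (R : realType) (t C : R) :
  0 <= t -> (forall k, t ^+ k <= C * k.+1%:R) -> t <= 1.
Proof.
move=> t0 tC; rewrite leNgt; apply/negP => t1.
pose h := t - 1; have h0 : 0 < h by rewrite subr_gt0.
(* The hypothesis is used at exponent [2 * k]: there the left side exceeds [k ^+ 2 * h ^+ 2], hence
   [3 * C * k], while the right side is [C * (2 * k + 1)]. *)
pose k := (Num.truncn (3 * C / h ^+ 2)).+1.
have kC : 3 * C < k%:R * h ^+ 2.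
  by rewrite -ltr_pdivrMr ?exprn_gt0 // truncnS_gt.
have k1 : 1 <= k%:R :> R by rewrite ler1n.
have := tC (k + k)%N; rewrite exprD.
have -> : (k + k).+1%:R = 2 * k%:R + 1 :> R by rewrite -natr1 natrD; ring.
have := bernoulli k (ltW t1); rewrite -/h.
move: k1 kC; set T := t ^+ k; set K := k%:R => k1 kC bk.
have Kh : 0 < K * h by rewrite mulr_gt0 //; lra.
have : (K * h) * (K * h) < T * T by rewrite ltr_pM //; lra.
have : 3 * C * K < K * h ^+ 2 * K by rewrite ltr_pM2r //; lra.
have C0 : 0 <= C by have := tC 0%N; rewrite expr0 mulr1; lra.
have : C <= C * K by rewrite ler_peMr.
have -> : K * h ^+ 2 * K = K * h * (K * h) by ring.
have -> : C * (2 * K + 1) = 2 * (C * K) + C by ring.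
have -> : 3 * C * K = 3 * (C * K) by ring.
set CK := C * K; set TT := T * T; set KH := _ * (K * h); lra.
Qed.

(** * Limits along ultrafilters in locally compact fields *)

Section LocallyCompact.
Variables (R : realType) (F : fieldType) (a : absolute_value R F).
Hypothesis a_local : local_field a.
Variables (U : set_system nat) (UU : UltraFilter U).

(* Limits along a fixed ultrafilter exist simultaneously for all bounded
   sequences, which replaces repeated extraction of subsequences. *)
Lemma bounded_ulim (u : nat -> F) (B : R) : (forall k, a (u k) <= B) ->
  exists x, forall e, 0 < e -> U [set k | a (u k - x) < e].
Proof.
move=> uB.
have [C nC [cC _]] := a_local (I : [set: valued a] (0 : F)).
have [r r0 rC] : exists2 r, 0 < r & forall x : F, a x < r -> C x.
  move: nC; rewrite withinET -nbhs_ballE => -[r /= r0 rC]; exists r => // x ax; apply: rC.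
  by rewrite /ball /= sub0r absvalN.
have [c c0 c1] := absval_gt1 a.
(* Division by a large power of [c] moves the whole sequence into the compact neighbourhood of 0. *)
have [m mB] := exp_unbounded (B / r) c1.
pose d := c ^+ m; have d0 : d != 0 by rewrite expf_neq0.
have ad0 : 0 < a d by rewrite absval_gt0.
have uC k : C (u k / d).
  apply: rC; rewrite absval_div ltr_pdivrMr // mulrC -ltr_pdivrMr //.
  apply: le_lt_trans (_ : B / r < _); first by rewrite ler_pM2r ?invr_gt0.
  by rewrite absvalX.
pose v k : valued a := u k / d.
have vC : U [set k | C (v k)] by apply: filterS (@filterT _ U _) => k _; exact: uC.
have [x [_ xU]] := cC (v @ U) _ vC.
exists (x * d) => e e0.
have [//|UN] := in_ultra_setVsetC [set k | a (u k - x * d) < e] UU.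
have [||y [[k kN <-]]] := xU (v @` (~` [set k | a (u k - x * d) < e]))
    (ball (x : valued a) (e / a d)).
- by apply: (@filterS _ U _ _ _ _ UN) => k kU /=; exists k.
- by apply: nbhsx_ballx; rewrite divr_gt0.
rewrite /ball /= absval_distC => kx; case: kN => /=.
have -> : u k - x * d = (u k / d - x) * d by rewrite mulrBl divfK.
by rewrite absvalM -ltr_pdivlMr.
Qed.

End LocallyCompact.

Section Ultrafilter.
Variables (U : set_system nat) (UU : UltraFilter U) (U_oo : \oo `<=` U).

Lemma ultra_ge N : U [set k | (N <= k)%N].
Proof. by apply: U_oo; exists N. Qed.

Lemma ultra_ex2 (A : set nat) : U A -> exists k l, (k < l)%N /\ A k /\ A l.
Proof.
move=> UA; have [k Ak] := filter_ex UA.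
have [l [Al lk]] := filter_ex (filterI UA (ultra_ge k.+1)).
by exists k, l.
Qed.

Lemma ultra_lt_inv (R : realType) (e : R) : 0 < e -> U [set k | k.+1%:R^-1 < e].
Proof.
move=> e0; apply: filterS (ultra_ge (Num.truncn e^-1)) => k /= kN.
rewrite invf_plt ?posrE // ?ltr0n //; apply: lt_le_trans (truncnS_gt _) _.
by rewrite ler_nat.
Qed.

End Ultrafilter.

Lemma exists_ultrafilter : exists U : set_system nat, UltraFilter U /\ \oo `<=` U.
Proof. exact: ultraFilterLemma. Qed.

(** * Ostrowski's dichotomy for the values at integers *)

Section IntegerValues.
Variables (R : realType) (F : fieldType) (a : absolute_value R F).

Lemma absval_natX (n k : nat) : a (n ^ k)%:R = a n%:R ^+ k.
Proof. by rewrite natrX absvalX. Qed.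

(** Binomial coefficients have absolute value at most 1, so [(x + y) ^+ k] is bounded by
    [(k + 1) * m ^+ k]; [exp_linear_le1] discards the factor linear in [k]. *)
Lemma ultrametric_of_nat : (forall n : nat, a n%:R <= 1) ->
  forall x y, a (x + y) <= Num.max (a x) (a y).
Proof.
move=> a_nat x y; set m := Num.max _ _.
have m0 : 0 <= m by rewrite le_max absval_ge0.
have [m0'|] := eqVneq m 0.
  have ax : a x <= 0 by rewrite -m0' le_max lexx.
  have ay : a y <= 0 by rewrite -m0' le_max lexx orbT.
  by rewrite m0'; apply: le_trans (absvalD _ _ _) _; lra.
move=> mn0; have {}m0 : 0 < m by rewrite lt_def mn0.
rewrite -(mul1r m) -ler_pdivrMr //; apply: (@exp_linear_le1 _ _ 1).
  by rewrite divr_ge0 ?absval_ge0 ?ltW.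
move=> k; rewrite mul1r expr_div_n ler_pdivrMr ?exprn_gt0 // -absvalX exprDn.
apply: le_trans (absval_sum _ _ _ _) _.
apply: le_trans (_ : _ <= \sum_(i < k.+1) m ^+ k) _; last first.
  by rewrite sumr_const card_ord mulr_natl.
apply: ler_sum => i _; rewrite -mulr_natl absvalM.
rewrite -[leRHS]mul1r ler_pM ?absval_ge0 //.
have -> : m ^+ k = m ^+ (k - i) * m ^+ i by rewrite -exprD subnK // leq_ord.
have xm : a x <= m by rewrite le_max lexx.
have ym : a y <= m by rewrite le_max lexx orbT.
by rewrite absvalM !absvalX ler_pM ?exprn_ge0 ?absval_ge0 // lerXn2r
     ?nnegrE ?absval_ge0 ?(ltW m0).
Qed.

(* n is expanded in base b. *)
Lemma absval_digits (b n l : nat) (A : R) :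
    (0 < b)%N -> 1 <= A -> a b%:R <= A -> (n < b ^ l)%N ->
  a n%:R <= b%:R * l%:R * A ^+ l.
Proof.
move=> b0 A1 bA; have A0 : 0 <= A by lra.
elim: l n => [|l IH] n.
  by rewrite expn0 ltnS leqn0 => /eqP ->; rewrite absval0 mulr0 mul0r.
rewrite expnS => nb; rewrite {1}(divn_eq n b) natrD natrM.
apply: le_trans (absvalD _ _ _) _; rewrite absvalM.
have /IH qb : (n %/ b < b ^ l)%N by rewrite ltn_divLR // mulnC.
have rb : a (n %% b)%:R <= b%:R.
  by apply: le_trans (absval_nat _ _) _; rewrite ler_nat ltnW // ltn_mod.
apply: le_trans (_ : _ <= b%:R * l%:R * A ^+ l * A + b%:R) _.
  apply: lerD => //; apply: ler_pM; rewrite ?absval_ge0 //.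
have Al : 1 <= A ^+ l.+1 by rewrite exprn_ege1.
rewrite -mulrA -exprSr -natr1 mulrDr mulr1 mulrDl lerD2l ler_peMr //.
Qed.

(** For [b >= 2], [n ^ k] has at most [k + 1] digits in base [b], which bounds its absolute value by
    [b * (k + 1) * A ^+ (k + 1)]; again [exp_linear_le1] removes the linear factor. *)
Lemma absval_nat_le (n b : nat) : (n <= b)%N ->
  a n%:R <= Num.max 1 (a b%:R).
Proof.
case: b => [|[|b]]; first by rewrite leqn0 => /eqP ->; rewrite le_max lexx orbT.
  by rewrite le_max; case: n => [|[|n]] // _; rewrite ?absval0 ?absval1 ?lexx ?ler01.
set B := b.+2 => nb; set A := Num.max _ _.
have A1 : 1 <= A by rewrite le_max lexx.
have bA : a B%:R <= A by rewrite le_max lexx orbT.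
have A0 : 0 < A by lra.
rewrite -(mul1r A) -ler_pdivrMr //; apply: (@exp_linear_le1 _ _ (B%:R * A)).
  by rewrite divr_ge0 ?absval_ge0 ?ltW.
move=> k; rewrite expr_div_n ler_pdivrMr ?exprn_gt0 // -absval_natX.
have -> : B%:R * A * k.+1%:R * A ^+ k = B%:R * k.+1%:R * A ^+ k.+1.
  by rewrite exprS; ring.
apply: absval_digits => //.
have [->|k0] := posnP k; first by rewrite expn0 expn1.
apply: leq_ltn_trans (_ : B ^ k < _)%N; first by rewrite leq_exp2r.
by rewrite ltn_exp2l.
Qed.

Hypothesis arch : exists m : nat, 1 < a m%:R.

(** If some [n >= 2] had absolute value below 1, then [m <= n ^ m] and [absval_nat_le] would bound
    the value at [m] by 1. *)
Lemma arch_nat_ge1 (n : nat) : (0 < n)%N -> 1 <= a n%:R.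
Proof.
have [m m1] := arch; case: n => [|[|n]] // _; first by rewrite absval1.
rewrite leNgt; apply/negP => n1.
have /absval_nat_le : (m <= n.+2 ^ m)%N by rewrite ltnW // ltn_expl.
have -> : Num.max 1 (a (n.+2 ^ m)%:R) = 1.
  by apply/max_idPl; rewrite absval_natX exprn_ile1 ?absval_ge0 // ltW.
by rewrite leNgt m1.
Qed.

Lemma arch_nat_le (n b : nat) : (0 < b)%N -> (n <= b)%N -> a n%:R <= a b%:R.
Proof.
by move=> b0 /absval_nat_le; have /max_idPr -> := arch_nat_ge1 b0.
Qed.

Lemma arch_nat_unbounded (B : R) :
  exists2 N, (0 < N)%N & forall n, (N <= n)%N -> B < a n%:R.
Proof.
have [m m1] := arch.
have m0 : (0 < m)%N by move: m1; case: m => //; rewrite absval0 ltr10.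
have [k kB] := exp_unbounded B m1.
exists (m ^ k)%N => [|n nk]; first by rewrite expn_gt0 m0.
apply: lt_le_trans (_ : a (m ^ k)%:R <= _); first by rewrite absval_natX.
by apply: arch_nat_le => //; apply: leq_trans nk; rewrite expn_gt0 m0.
Qed.

End IntegerValues.

(** * Comparison of coordinates with the absolute value of a finite extension *)

Section ExtendedAbsoluteValue.
Variables (R : realType) (F : fieldType) (K : fieldExtType F).
Variables (aF : absolute_value R F) (aK : absolute_value R K).
Hypothesis F_local : local_field aF.
Hypothesis aK_extends_aF : forall x : F, aK x%:A = aF x.

Lemma absvalZ c (x : K) : aK (c *: x) = aF c * aK x.
Proof. by rewrite -aK_extends_aF -absvalM mulr_algl. Qed.

(* The unit sphere of F^m for the sup norm is compact, so the continuous
   function c |-> |\sum_i c_i e_i| is bounded below on it. *)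
Lemma coord_bound m (e : 'I_m -> K) :
    (forall c : 'I_m -> F, \sum_i c i *: e i = 0 -> forall i, c i = 0) ->
  exists2 C, 0 < C & forall c i, aF (c i) <= C * aK (\sum_j c j *: e j).
Proof.
move=> e_free; apply: contrapT => noC.
have [U [UU Uoo]] := exists_ultrafilter.
have bad (k : nat) : exists c : 'I_m -> F, exists i0,
    [/\ c i0 = 1, forall i, aF (c i) <= 1 & aK (\sum_j c j *: e j) < k.+1%:R^-1].
  apply: contrapT => no_c; apply: noC; exists k.+1%:R => // c i.
  pose i0 := [arg max_(i' > i) aF (c i')]%O.
  have ci0 j : aF (c j) <= aF (c i0) by rewrite /i0; case: arg_maxP => // i' _; apply.
  have [z|ci0n0] := eqVneq (c i0) 0.
    by apply: le_trans (ci0 i) _; rewrite z absval0 mulr_ge0 ?absval_ge0.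
  have pos := absval_gt0 aF ci0n0.
  rewrite leNgt; apply/negP => lt_i; apply: no_c.
  exists (fun j => c j / c i0), i0; split; first by rewrite divff.
    by move=> j; rewrite absval_div ler_pdivrMr // mul1r.
  have -> : \sum_j (c j / c i0) *: e j = (c i0)^-1 *: \sum_j c j *: e j.
    by rewrite scaler_sumr; apply: eq_bigr => j _; rewrite scalerA mulrC.
  rewrite absvalZ absvalV mulrC ltr_pdivrMr // mulrC ltr_pdivlMr // mulrC.
  exact: lt_le_trans lt_i _.
have [c /choice[i0 cP]] := choice bad.
have lim i : exists x, forall r, 0 < r -> U [set k | aF (c k i - x) < r].
  by apply: (@bounded_ulim _ _ _ F_local _ _ _ 1) => k; case: (cP k).
have [x xP] := choice lim.
have Ub r : 0 < r -> U [set k | forall i, aF (c k i - x i) < r].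
  by move=> r0; apply: filter_forall => i; exact: xP.
have sum0 : \sum_j x j *: e j = 0.
  apply: (@absval_eq0 _ _ aK); apply/eqP; rewrite eq_le absval_ge0 andbT.
  pose S := \sum_j aK (e j); have S0 : 0 <= S by rewrite sumr_ge0 // => ? _; exact: absval_ge0.
  rewrite leNgt; apply/negP => pos.
  set s := aK _ in pos.
  have r0 : 0 < s / 2 / (S + 1) by rewrite !divr_gt0 // ltr_wpDl.
  have s2 : 0 < s / 2 by rewrite divr_gt0.
  have [k [kb ks]] := filter_ex (filterI (Ub _ r0) (ultra_lt_inv UU Uoo s2)).
  have [_ _ kS] := cP k.
  have : s <= aK (\sum_j c k j *: e j) + s / 2 / (S + 1) * S.
    have sE : s = aK (\sum_j c k j *: e j - \sum_j (c k j - x j) *: e j).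
      rewrite /s; congr (aK _); rewrite -sumrB; apply: eq_bigr => j _.
      by rewrite -scalerBl opprB addrC subrK.
    rewrite {1}sE; apply: le_trans (absvalD _ _ _) _; rewrite absvalN lerD2l.
    apply: le_trans (absval_sum _ _ _ _) _; rewrite /S mulr_sumr.
    by apply: ler_sum => j _; rewrite absvalZ ler_wpM2r ?absval_ge0 // ltW //; apply: kb.
  have : s / 2 / (S + 1) * S <= s / 2.
    by rewrite mulrAC ler_pdivrMr ?ltr_wpDl // ler_wpM2l ?ltW // ltrDl ltr01.
  move=> H1 H2; have := lt_trans kS ks.
  by rewrite ltNge; move/negP; apply; lra.
(* The position [i0 k] of the coordinate 1 depends on [k], so closeness to the limit 0 is needed in
   all coordinates at once. *)
have [k kb] := filter_ex (Ub _ (ltr01 : 0 < 1 :> R)).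
have [ck1 _ _] := cP k; have := kb (i0 k).
by rewrite (e_free _ sum0) subr0 ck1 absval1 ltxx.
Qed.

End ExtendedAbsoluteValue.

(** * Cyclic vectors *)

Section CyclicVector.
Variables (F : fieldType) (V : lmodType F) (f : {linear V -> V}).
Implicit Types (p g d : {poly F}) (v w : V).

(** This is p(f)v: [V] becomes a module over the polynomials, the variable acting as [f]. *)
Definition poly_act p v := \sum_(i < size p) p`_i *: iter i f v.

Lemma iter_linearD i v w : iter i f (v + w) = iter i f v + iter i f w.
Proof. by elim: i => //= i ->; rewrite linearD. Qed.

Lemma poly_act_wide n p v : (size p <= n)%N ->
  poly_act p v = \sum_(i < n) p`_i *: iter i f v.
Proof.
move=> pn; rewrite /poly_act (big_ord_widen n (fun i => p`_i *: iter i f v)) //.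
rewrite big_mkcond; apply: eq_bigr => i _.
by case: ltnP => // ip; rewrite nth_default // scale0r.
Qed.

Lemma poly_actD p g v : poly_act (p + g) v = poly_act p v + poly_act g v.
Proof.
pose n := maxn (size p) (size g).
rewrite !(@poly_act_wide n) ?leq_maxl ?leq_maxr ?size_polyD // -big_split /=.
by apply: eq_bigr => i _; rewrite coefD scalerDl.
Qed.

Lemma poly_actvD p v w : poly_act p (v + w) = poly_act p v + poly_act p w.
Proof.
by rewrite -big_split /=; apply: eq_bigr => i _; rewrite iter_linearD scalerDr.
Qed.

Lemma poly_act0v p : poly_act p 0 = 0.
Proof. by apply: (addrI (poly_act p 0)); rewrite -poly_actvD !addr0. Qed.

Lemma poly_actvN p v : poly_act p (- v) = - poly_act p v.
Proof.
by apply: (addrI (poly_act p v)); rewrite -poly_actvD !subrr poly_act0v.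
Qed.

Lemma poly_actC c v : poly_act c%:P v = c *: v.
Proof.
by rewrite (@poly_act_wide 1) ?size_polyC_leq1 // big_ord1 coefC.
Qed.

Lemma poly_actCM c p v : poly_act (c%:P * p) v = c *: poly_act p v.
Proof.
rewrite !(@poly_act_wide (size p)) //; last first.
  by rewrite mul_polyC size_scale_leq.
by rewrite scaler_sumr; apply: eq_bigr => i _; rewrite coefCM scalerA.
Qed.

Lemma poly_actMX p v : poly_act (p * 'X) v = poly_act p (f v).
Proof.
rewrite (@poly_act_wide (size p).+1); last first.
  by apply: leq_trans (size_polyMleq _ _) _; rewrite size_polyX addn2.
rewrite big_ord_recl coefMX eqxx scale0r add0r.
by apply: eq_bigr => i _; rewrite coefMX /= -iterSr.
Qed.

Lemma poly_actXM p v : poly_act ('X * p) v = f (poly_act p v).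
Proof.
rewrite mulrC poly_actMX linear_sum; apply: eq_bigr => i _.
by rewrite linearZ /= -iterSr.
Qed.

Lemma poly_actM p g v : poly_act (p * g) v = poly_act p (poly_act g v).
Proof.
elim/poly_ind: p g v => [|p c IH] g v.
  by rewrite mul0r /poly_act size_poly0 !big_ord0.
rewrite mulrDl -mulrA !poly_actD poly_actC poly_actCM IH.
by rewrite poly_actXM poly_actMX.
Qed.

Lemma annihilator_poly p v : p != 0 -> poly_act p v = 0 ->
  exists m, [/\ m != 0, poly_act m v = 0 &
    forall g, poly_act g v = 0 -> m %| g].
Proof.
move=> p0 pv.
pose P n := `[< exists m, [/\ m != 0, poly_act m v = 0 & size m = n] >].
have exP : exists n, P n by exists (size p); apply/asboolP; exists p.
case: (ex_minnP exP) => n /asboolP[m [m0 mv <-]] min_m.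
exists m; split => // g gv; apply: contrapT => /negP ndvd.
have : P (size (g %% m)).
  apply/asboolP; exists (g %% m); split => //.
  by move: gv; rewrite {1}(divp_eq g m) poly_actD poly_actM mv poly_act0v add0r.
by move/min_m; rewrite leqNgt ltn_modp m0.
Qed.

Variable q : nat.
Hypotheses (q_neq0 : q%:R != 0 :> F) (fq : forall v, iter q f v = v).
Hypothesis f_indep : forall p, (size p <= q)%N ->
  (forall v, poly_act p v = 0) -> p = 0.

(* X^q - 1 is separable, so annihilators multiply along coprime factors: a
   vector with annihilator d, a proper divisor, is improved by adding a vector
   of the nonzero space d(f)V, which is killed by the cofactor of d. *)
Lemma exists_cyclic_vector :
  exists v, forall p, (size p <= q)%N -> poly_act p v = 0 -> p = 0.
Proof.
have q0 : (0 < q)%N by move: q_neq0; case: q => //; rewrite eqxx.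
pose N : {poly F} := 'X^q - 1.
have sN : size N = q.+1 by rewrite size_XnsubC.
have N0 : N != 0 by rewrite -size_poly_eq0 sN.
have actN v : poly_act N v = 0.
  rewrite /N -[X in _ - X]polyC1 -polyCN poly_actD poly_actC scaleN1r.
  have -> w : poly_act 'X^q w = iter q f w.
    elim: (q) => [|n IH]; first by rewrite expr0 -polyC1 poly_actC scale1r.
    by rewrite exprS poly_actXM IH.
  by rewrite fq subrr.
have sepN : separable_poly N by rewrite separable_Xn_sub_1.
pose C d := exists v, poly_act d v = 0 /\ forall g, poly_act g v = 0 -> d %| g.
suff [v [_ vN]] : C N.
  exists v => p pq /vN /dvdp_leq; case: eqVneq => // _ /(_ isT).
  by rewrite sN leqNgt ltnS pq.
have full d : (size N <= size d)%N -> d %| N -> C d -> C N.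
  move=> le_Nd dN [v [dv vd]].
  have /andP[_ Nd] : d %= N.
    rewrite -(dvdp_size_eqp dN) eqn_leq le_Nd. by rewrite dvdp_leq.
  by exists v; split=> [|g gv]; [exact: actN|exact: dvdp_trans Nd (vd _ gv)].
(* [k] bounds the degree still missing between [d] and [N]. *)
have main k d : (size N <= size d + k)%N -> d %| N -> C d -> C N.
  elim: k d => [|k IH] d szd dN Cd; first by apply: (full d) => //; rewrite -(addn0 (size d)).
  have [le_Nd|lt_sd] := leqP (size N) (size d); first exact: (full d).
  have [v [dv vd]] := Cd.
  have [e Ned] := dvdpP _ _ dN.
  have [e0 d0] : e != 0 /\ d != 0 by apply/andP; rewrite -negb_or -mulf_eq0 -Ned.
  have [y dy] : exists y, poly_act d y != 0.
    apply: contrapT => no_y; move/eqP: d0; apply; apply: f_indep.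
      by rewrite -ltnS -sN.
    by move=> w; apply/eqP; apply: contrapT => /negP dw; apply: no_y; exists w.
  set w := poly_act d y in dy.
  have ew : poly_act e w = 0 by rewrite -poly_actM -Ned actN.
  have [m [m0 mw minm]] := annihilator_poly e0 ew.
  have /andP[_ /andP[_ co_ed]] : [&& separable_poly e, separable_poly d & coprimep e d].
    by rewrite -separable_mul -Ned.
  have me := minm _ ew.
  have co_md : coprimep m d by apply: coprimep_dvdr me co_ed.
  have sm : (1 < size m)%N.
    rewrite ltnNge; apply/negP => /size1_polyC mC.
    move: mw m0; rewrite mC poly_actC polyC_eq0 => /eqP.
    by rewrite scaler_eq0 (negPf dy) orbF => /eqP ->; rewrite eqxx.
  apply: (IH (m * d)); first 2 last.
  - exists (v + w); split=> [|g gvw].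
      rewrite poly_actvD poly_actM dv poly_act0v add0r mulrC poly_actM mw.
      exact: poly_act0v.
    (* The element g v = - g w is killed by [d] and by [m], so [m * g] kills [v] and [d * g] kills
       [w]; coprimality removes the extra factors. *)
    have gv : poly_act g v = - poly_act g w.
      by apply/eqP; rewrite -addr_eq0 -poly_actvD gvw.
    rewrite Gauss_dvdp //; apply/andP; split.
      rewrite -(Gauss_dvdpr g co_md); apply: minm.
      rewrite poly_actM -[poly_act g w]opprK -gv poly_actvN -poly_actM mulrC.
      by rewrite poly_actM dv poly_act0v oppr0.
    rewrite -(Gauss_dvdpr g (_ : coprimep d m)); last by rewrite coprimep_sym.
    apply: vd; rewrite poly_actM gv poly_actvN -poly_actM mulrC poly_actM mw.
    by rewrite poly_act0v oppr0.
  - rewrite size_mul //; case: (size m) sm => [//|[//|l]] _.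
    by apply: leq_trans szd _; rewrite addSnnS; move: (size d) (k) => *; lia.
  - by rewrite Ned dvdp_mul2r.
apply: (main (size N) 1) => //; first exact: leq_addl.
  exact: dvd1p.
by exists 0; split=> [|g _]; rewrite ?poly_act0v ?dvd1p.
Qed.

End CyclicVector.

(** * Indices of multiplicative subgroups *)

Section IndexTheory.
Variable K : fieldType.
Implicit Types (A B C : set K) (x y : K).

Definition mulgrp A := [/\ A 1, ~ A 0 & forall x y, A x -> A y -> A (x / y)].

Definition nonzero : set K := [set x | x != 0].

Lemma mulgrp_nonzero : mulgrp nonzero.
Proof.
split=> [||x y /= x0 y0]; rewrite /nonzero /= ?oner_eq0 ?eqxx //.
by rewrite mulf_neq0 ?invr_eq0.
Qed.

Lemma mulgrp_neq0 A x : mulgrp A -> A x -> x != 0.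
Proof. by case=> _ A0 _ Ax; apply/eqP => x0; apply: A0; rewrite -x0. Qed.

Lemma mulgrpV A x : mulgrp A -> A x -> A x^-1.
Proof. by case=> A1 _ Ad Ax; rewrite -div1r; apply: Ad. Qed.

Lemma mulgrpM A x y : mulgrp A -> A x -> A y -> A (x * y).
Proof.
by move=> gA Ax Ay; rewrite -[y]invrK; case: (gA) => _ _; apply=> //; exact: mulgrpV.
Qed.

Lemma mulgrpX A x k : mulgrp A -> A x -> A (x ^+ k).
Proof.
move=> gA Ax; elim: k => [|k IH]; first by rewrite expr0; case: gA.
by rewrite exprS; apply: mulgrpM.
Qed.

Lemma mulgrpI A B : mulgrp A -> mulgrp B -> mulgrp (A `&` B).
Proof.
move=> [A1 A0 Ad] [B1 B0 Bd]; split=> [|[/A0]//|x y [Ax Bx] [Ay By]] //.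
by split; [apply: Ad|apply: Bd].
Qed.

(* The index of B in A, through a labelling of the cosets: values of the
   labelling outside A are irrelevant, and B need not be contained in A. *)
Definition coset_index A B (d : nat) := exists (T : finType) (r : K -> T),
  (forall x y, A x -> A y -> r x = r y <-> B (x / y)) /\
  #|[set i | `[< exists2 x, A x & r x = i >]]%SET| = d.

(** One implication only: a labelling finer than the cosets is easier to produce, and [index_exists]
    makes it exact. *)
Definition finite_index A B := exists (T : finType) (r : K -> T),
  forall x y, A x -> A y -> r x = r y -> B (x / y).

(** The labelling is evaluated on a chosen representative of each coset. [xget] picks the same one
    for [x] and [y] in a common coset, because the two sets it chooses from coincide. *)
Lemma index_exists A B : mulgrp B -> finite_index A B -> A `<=` nonzero ->
  exists d, coset_index A B d.
Proof.
move=> gB [T [r rP]] A0; have [B1 _ Bd] := gB.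
pose rep x := xget 1 [set y | A y /\ B (y / x)].
have repP x : A x -> A (rep x) /\ B (rep x / x).
  move=> Ax; rewrite /rep; case: xgetP => [y _ //|no].
  by case: (no x); split=> //; rewrite divff //; exact: A0.
exists #|[set i | `[< exists2 x, A x & (r \o rep) x = i >]]%SET|, T, (r \o rep).
split=> // x y Ax Ay /=.
have [[Arx Brx] [Ary Bry]] := (repP x Ax, repP y Ay).
have [x0 y0] := (A0 x Ax, A0 y Ay).
have [rx0 ry0] := (A0 _ Arx, A0 _ Ary).
split=> [/(rP _ _ Arx Ary) Brr|Bxy].
  have -> : x / y = (rep x / rep y) / (rep x / x) * (rep y / y).
    by field; rewrite x0 y0 rx0 ry0.
  by apply: mulgrpM => //; apply: Bd.
congr r; congr (xget 1 _); apply/seteqP; split=> z [Az Bz]; split=> //.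
  have -> : z / y = (z / x) * (x / y) by field; rewrite x0 y0.
  exact: mulgrpM.
have -> : z / x = (z / y) / (x / y) by field; rewrite x0 y0.
exact: Bd.
Qed.

Lemma index_surj_leq A B A' B' d d' (f : K -> K) :
    (forall x, A x -> A' (f x)) ->
    (forall x y, A x -> A y -> B (x / y) -> B' (f x / f y)) ->
    (forall y, A' y -> exists2 x, A x & B' (f x / y)) ->
  coset_index A B d -> coset_index A' B' d' -> (d' <= d)%N.
Proof.
move=> fA fB f_surj [T [r [rP <-]]] [T' [r' [r'P <-]]].
set S' := [set i : T' | _]%SET; set S := [set i : T | _]%SET.
(* [None] serves the labels carried by no element of [A]. *)
pose g (i : T) : option T' :=
  match pselect (exists2 x, A x & r x = i) with
  | left e => Some (r' (f (s2val (cid2 e)))) | right _ => None end.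
have g_in x : A x -> g (r x) = Some (r' (f x)).
  move=> Ax; rewrite /g; case: pselect => [e|[]]; last by exists x.
  case: (cid2 e) => y Ay ry /=; congr Some.
  by apply/(r'P _ _ (fA _ Ay) (fA _ Ax)); apply: fB => //; apply/rP.
rewrite -(card_imset (mem S') Some_inj).
apply: leq_trans _ (leq_imset_card g S); apply: subset_leq_card.
apply/fintype.subsetP => _ /imsetP[j jS' ->].
move: jS'; rewrite inE => /asboolP[y A'y <-].
have [x Ax fxy] := f_surj y A'y.
apply/imsetP; exists (r x); first by rewrite inE; apply/asboolP; exists x.
by rewrite g_in //; congr Some; apply/esym/(r'P _ _ (fA _ Ax) A'y).
Qed.

Lemma index_uniq A B d d' : mulgrp B -> A `<=` nonzero ->
  coset_index A B d -> coset_index A B d' -> d = d'.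
Proof.
move=> [B1 _ _] A0 i1 i2; apply/eqP; rewrite eqn_leq.
by apply/andP; split; [apply: (index_surj_leq (f := id) _ _ _ i2 i1)
  |apply: (index_surj_leq (f := id) _ _ _ i1 i2)] => // y Ay;
  exists y => //; rewrite divff //; exact: A0.
Qed.

Lemma index_pullback A B A' B' d (f : K -> K) :
    (forall x, A x -> A' (f x)) ->
    (forall x y, A x -> A y -> B (x / y) <-> B' (f x / f y)) ->
    (forall y, A' y -> exists2 x, A x & B' (f x / y)) ->
  coset_index A' B' d -> coset_index A B d.
Proof.
move=> fA fB f_surj [T [r [rP <-]]]; exists T, (r \o f); split=> [x y Ax Ay /=|].
  by rewrite rP ?fB //; apply: fA.
apply: eq_card => i; rewrite !inE; apply/asboolP/asboolP => -[x Ax <-].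
  by exists (f x) => //; exact: fA.
by have [y Ay Bxy] := f_surj x Ax; exists y => //; apply/rP => //; exact: fA.
Qed.

(** A section [g] of the induced bijection of cosets meets the hypotheses of [index_pullback] in the
    opposite direction. *)
Lemma index_pushforward A B A' B' d (f : K -> K) :
    mulgrp B -> mulgrp B' -> A `<=` nonzero -> A' `<=` nonzero ->
    (forall x, A x -> A' (f x)) ->
    (forall x y, A x -> A y -> B (x / y) <-> B' (f x / f y)) ->
    (forall y, A' y -> exists2 x, A x & B' (f x / y)) ->
  coset_index A B d -> coset_index A' B' d.
Proof.
move=> gB gB' A0 A'0 fA fB f_surj.
have /choice[g gP] y : exists x, A' y -> A x /\ B' (f x / y).
  have [A'y|nA'y] := pselect (A' y); last by exists 0.
  by have [x Ax fxy] := f_surj y A'y; exists x.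
have [_ _ Bd'] := gB'.
apply: (index_pullback (f := g)).
- by move=> y /gP[].
- move=> x y A'x A'y.
  have [[Agx Bx] [Agy By]] := (gP _ A'x, gP _ A'y).
  have [[x0 y0] [fx0 fy0]] := ((A'0 _ A'x, A'0 _ A'y), (A'0 _ (fA _ Agx), A'0 _ (fA _ Agy))).
  split=> H.
    apply/fB => //.
    have -> : f (g x) / f (g y) = (f (g x) / x) / (f (g y) / y) * (x / y).
      by field; rewrite x0 y0 fy0.
    by apply: mulgrpM => //; apply: Bd'.
  have -> : x / y = (f (g x) / f (g y)) * (f (g y) / y) / (f (g x) / x).
    by field; rewrite x0 y0 fx0 fy0.
  by apply: Bd' => //; apply: mulgrpM => //; apply/fB.
- move=> x Ax; exists (f x); first exact: fA.
  have [Agx Bx] := gP _ (fA _ Ax).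
  by apply/fB.
Qed.

(** An element is labelled by its coset modulo [C] together with the coset modulo [B] of its
    quotient by a fixed representative. *)
Lemma index_mul A B C d1 d2 : mulgrp A -> mulgrp B -> mulgrp C ->
    C `<=` A -> B `<=` C ->
  coset_index A C d1 -> coset_index C B d2 -> coset_index A B (d1 * d2).
Proof.
move=> gA gB gC CA BC [T [r [rP <-]]] [T' [r' [r'P <-]]].
have [A1 _ Ad] := gA.
pose s i := xget 1 [set x | A x /\ r x = i].
have sP x : A x -> A (s (r x)) /\ r (s (r x)) = r x.
  by move=> Ax; rewrite /s; case: xgetP => [y _ //|/(_ x) []].
have sC x : A x -> C (x / s (r x)).
  by move=> Ax; have [As rs] := sP x Ax; apply/rP.
have n0 x := @mulgrp_neq0 A x gA.
exists (T * T')%type, (fun x => (r x, r' (x / s (r x)))); split.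
  move=> x y Ax Ay; have [As rs] := sP x Ax; have [As' rs'] := sP y Ay.
  split=> [[rxy]|Bxy].
    rewrite -rxy; move/r'P => H.
    have -> : x / y = (x / s (r x)) / (y / s (r x)) by field; rewrite !n0.
    apply: H; first exact: sC.
    by rewrite rxy; exact: sC.
  have rxy : r x = r y by apply/rP => //; exact: BC.
  rewrite rxy; congr pair; apply/r'P; [by rewrite -rxy; exact: sC|exact: sC|].
  have -> : (x / s (r y)) / (y / s (r y)) = x / y by field; rewrite !n0.
  by [].
rewrite -cardsX; apply: eq_card => -[i j]; rewrite !inE /=.
apply/asboolP/andP.
  case=> x Ax [<- <-]; split; apply/asboolP; first by exists x.
  by exists (x / s (r x)) => //; exact: sC.
case=> /asboolP[x Ax <-] /asboolP[y Cy <-].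
have [As rs] := sP x Ax.
have Ays : A (y * s (r x)) by apply: mulgrpM => //; exact: CA.
have rys : r (y * s (r x)) = r x.
  by rewrite -[RHS]rs; apply/rP => //; rewrite mulfK ?n0.
by exists (y * s (r x)) => //; rewrite rys mulfK ?n0.
Qed.

Lemma finite_index_sub A B A' B' : A' `<=` A -> B `<=` B' ->
  finite_index A B -> finite_index A' B'.
Proof.
move=> AA BB [T [r rP]]; exists T, r => x y Ax Ay rxy.
by apply/BB/rP => //; exact: AA.
Qed.

End IndexTheory.

(** * Invariance of the Herbrand quotient under passage to a subgroup of finite index *)

Section Herbrand.
Variable K : fieldType.
Implicit Types (A B C : set K) (x y : K).

Lemma index_gt0 A B d : mulgrp A -> coset_index A B d -> (0 < d)%N.
Proof.
move=> [A1 _ _] [T [r [_ <-]]]; apply/card_gt0P; exists (r 1).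
by rewrite inE; apply/asboolP; exists 1.
Qed.

Lemma index_finite A B d : coset_index A B d -> finite_index A B.
Proof.
by move=> [T [r [rP _]]]; exists T, r => x y Ax Ay /(rP x y Ax Ay).
Qed.

Definition kernel_of (f : K -> K) : set K := [set x | x != 0 /\ f x = 1].

Variables f g : K -> K.
Hypotheses (f_neq0 : forall x, x != 0 -> f x != 0)
           (g_neq0 : forall x, x != 0 -> g x != 0).
Hypotheses (f_div : forall x y, f (x / y) = f x / f y)
           (g_div : forall x y, g (x / y) = g x / g y).

Lemma div_morph1 (h : K -> K) : (forall x, x != 0 -> h x != 0) ->
  (forall x y, h (x / y) = h x / h y) -> h 1 = 1.
Proof.
by move=> h0 hd; rewrite -[X in h X](divff (oner_neq0 K)) hd divff ?h0 ?oner_neq0.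
Qed.

Lemma mulgrp_image (h : K -> K) A : (forall x, x != 0 -> h x != 0) ->
  (forall x y, h (x / y) = h x / h y) -> mulgrp A -> mulgrp (h @` A).
Proof.
move=> h0 hd gA; have n0 x := @mulgrp_neq0 _ A x gA.
have [A1 A0 Ad] := gA; split.
- by exists 1 => //; exact: div_morph1.
- by move=> [x Ax hx]; have := h0 x (n0 x Ax); rewrite hx eqxx.
- by move=> _ _ [x Ax <-] [y Ay <-]; exists (x / y); rewrite ?hd //; exact: Ad.
Qed.

Lemma mulgrp_preimage (h : K -> K) B : (forall x, x != 0 -> h x != 0) ->
    (forall x y, h (x / y) = h x / h y) -> mulgrp B ->
  mulgrp [set x | x != 0 /\ B (h x)].
Proof.
move=> h0 hd [B1 B0 Bd]; split=> /=.
- split; first exact: oner_neq0.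
  by rewrite div_morph1.
- by case; rewrite eqxx.
- move=> x y [x0 Bx] [y0 By]; rewrite hd; split; last exact: Bd.
  by rewrite mulf_neq0 ?invr_eq0.
Qed.

Lemma mulgrp_kernel (h : K -> K) : (forall x, x != 0 -> h x != 0) ->
  (forall x y, h (x / y) = h x / h y) -> mulgrp (kernel_of h).
Proof.
move=> h0 hd; apply: (mulgrp_preimage (B := [set 1])) => //.
split=> [//|/= /eqP|x y /= -> ->]; last by rewrite divff ?oner_neq0.
by rewrite eq_sym oner_eq0.
Qed.

Lemma index_preimage (h : K -> K) B d : (forall x, x != 0 -> h x != 0) ->
    (forall x y, h (x / y) = h x / h y) -> mulgrp B ->
    coset_index (@nonzero K) [set x | x != 0 /\ (h @` B) (h x)] d ->
  coset_index (h @` @nonzero K) (h @` B) d.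
Proof.
move=> h0 hd gB; have ghB := mulgrp_image h0 hd gB.
have n0 : h @` @nonzero K `<=` @nonzero K by move=> _ [x x0 <-]; exact: h0.
apply: (index_pushforward (f := h) _ ghB) => //.
- exact: mulgrp_preimage.
- move=> x y x0 y0; rewrite -hd; split=> [[]//|hB]; split=> //.
  by rewrite mulf_neq0 ?invr_eq0.
- move=> _ [x x0 <-]; exists x => //; rewrite divff ?h0 //.
  by case: ghB.
Qed.

Lemma index_kernel_preimage (h : K -> K) B d : (forall x, x != 0 -> h x != 0) ->
    (forall x y, h (x / y) = h x / h y) -> mulgrp B ->
    coset_index (kernel_of h) (kernel_of h `&` B) d ->
  coset_index [set x | x != 0 /\ (h @` B) (h x)] B d.
Proof.
move=> h0 hd gB; have gk := mulgrp_kernel h0 hd.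
have n0 x := @mulgrp_neq0 _ _ x gB; have [B1 _ Bd] := gB.
apply: (index_pushforward (f := id)) => //.
- exact: mulgrpI.
- by move=> x [].
- by move=> x [].
- by move=> x [x0 hx]; split=> //; exists 1 => //; rewrite hx div_morph1.
- by move=> x y kx ky; split=> [[]//|Bxy]; split=> //; case: gk => _ _; apply.
- move=> y [y0 [b Bb hb]]; exists (y / b).
    split; first by rewrite mulf_neq0 ?invr_eq0 ?(n0 b).
    by rewrite hd hb divff ?h0.
  by rewrite mulrAC divff // mul1r; exact: mulgrpV.
Qed.

Hypotheses (fg1 : forall x, x != 0 -> f (g x) = 1)
           (gf1 : forall x, x != 0 -> g (f x) = 1).
Hypothesis hilbert90 : forall x, x != 0 -> f x = 1 -> exists2 y, y != 0 & x = g y.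
Variables (B : set K) (q : nat).
Hypotheses (gB : mulgrp B) (B_finite : finite_index (@nonzero K) B).
Hypotheses (f_B : forall x, B x -> B (f x)) (g_B : forall x, B x -> B (g x)).
Hypothesis B_hilbert90 : forall x, B x -> f x = 1 -> exists2 y, B y & x = g y.
Hypothesis B_index : coset_index (kernel_of g `&` B) (f @` B) q.

(* With A the multiplicative group of K, counting A/B along f and along g gives
   [fA : fB] = [ker g : ker g /\ B]; then compute [ker g : fB] in two ways. *)
Lemma herbrand_index : coset_index (kernel_of g) (f @` @nonzero K) q.
Proof.
have n0 x := @mulgrp_neq0 _ _ x gB.
have gA := mulgrp_nonzero K.
(* [LB] and [kB] are the products of [B] with the kernels of [g] and of [f]. *)
pose LB : set K := [set x | x != 0 /\ (g @` B) (g x)].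
pose kB : set K := [set x | x != 0 /\ (f @` B) (f x)].
have gLB : mulgrp LB by apply: mulgrp_preimage => //; exact: mulgrp_image.
have gkB : mulgrp kB by apply: mulgrp_preimage => //; exact: mulgrp_image.
have gL : mulgrp (kernel_of g) by exact: mulgrp_kernel.
have gfA : mulgrp (f @` @nonzero K) by exact: mulgrp_image.
have gfB : mulgrp (f @` B) by exact: mulgrp_image.
have BLB : B `<=` LB by move=> x Bx; split; [exact: n0|exists x].
have BkB : B `<=` kB by move=> x Bx; split; [exact: n0|exists x].
have L0 : kernel_of g `<=` @nonzero K by move=> x [].
have [u iu] : exists d, coset_index (@nonzero K) LB d.
  by apply: index_exists => //; exact: finite_index_sub B_finite.
have [m im] : exists d, coset_index (@nonzero K) kB d.
  by apply: index_exists => //; exact: finite_index_sub B_finite.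
have [l il] : exists d, coset_index (kernel_of g) (kernel_of g `&` B) d.
  apply: index_exists => //; first exact: mulgrpI.
  have [T [r rP]] := B_finite; exists T, r => x y Lx Ly rxy; split.
    by case: gL => _ _; apply.
  by apply: rP rxy; [case: Lx|case: Ly].
have i1 : coset_index (@nonzero K) B (u * l).
  apply: (index_mul gA gB gLB _ BLB iu); first by move=> x [].
  exact: index_kernel_preimage.
(* Hilbert 90 in [K] and in [B] shows that the index of [B] in [kB] is that of g(B) in g(A), namely
   [u]. So [u] occurs in both factorizations of the index of [B] and cancels. *)
have kerf : kernel_of f = g @` @nonzero K.
  apply/seteqP; split=> [x [x0 fx]|_ [x x0 <-]].
    by have [y y0 ->] := hilbert90 x0 fx; exists y.
  by split; [exact: g_neq0|exact: fg1].
have kerfB : kernel_of f `&` B = g @` B.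
  apply/seteqP; split=> [x [[x0 fx] Bx]|_ [x Bx <-]].
    by have [y y0 ->] := B_hilbert90 Bx fx; exists y.
  by split; [split; [exact/g_neq0/n0|exact/fg1/n0]|exact: g_B].
have i2 : coset_index (@nonzero K) B (m * u).
  apply: (index_mul gA gB gkB _ BkB im); first by move=> x [].
  apply: index_kernel_preimage => //.
  by rewrite kerfB kerf; exact: index_preimage.
have u0 := index_gt0 gA iu.
have lm : l = m.
  apply/eqP; rewrite -(eqn_pmul2l u0) [X in _ == X]mulnC.
  by apply/eqP; exact: (index_uniq gB _ i1 i2).
have ifB : coset_index (f @` @nonzero K) (f @` B) l by rewrite lm; exact: index_preimage.
have fBL : f @` B `<=` kernel_of g `&` B.
  by move=> _ [x Bx <-]; split; [split; [exact/f_neq0/n0|exact/gf1/n0]|exact: f_B].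
have i3 : coset_index (kernel_of g) (f @` B) (l * q).
  by apply: (index_mul gL gfB _ _ fBL il B_index); [exact: mulgrpI|move=> x []].
have fAL : f @` @nonzero K `<=` kernel_of g.
  by move=> _ [x x0 <-]; split; [exact: f_neq0|exact: gf1].
have fBA : f @` B `<=` f @` @nonzero K by move=> _ [x /n0 x0 <-]; exists x.
have [h ih] : exists d, coset_index (kernel_of g) (f @` @nonzero K) d.
  by apply: index_exists => //; exact: finite_index_sub (index_finite i3).
have i4 := index_mul gL gfB gfA fAL fBA ih ifB.
have l0 := index_gt0 gL il.
suff -> : q = h by [].
apply/eqP; rewrite -(eqn_pmul2l l0) [X in _ == X]mulnC.
by apply/eqP; exact: (index_uniq gfB L0 i3 i4).
Qed.

End Herbrand.

(** * Cohomology of small balls around 1 *)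

Section UnitFiltration.
Variables (R : realType) (K : fieldType) (nrm : K -> R) (D r : R).
Hypotheses (nrm0 : nrm 0 = 0) (nrm_ge0 : forall x, 0 <= nrm x)
  (nrm_eq0 : forall x, nrm x = 0 -> x = 0)
  (nrmB : forall x y, nrm (x - y) <= Num.max (nrm x) (nrm y))
  (nrmM : forall x y, nrm (x * y) <= D * nrm x * nrm y).
Hypotheses (D_gt0 : 0 < D) (r_gt0 : 0 < r) (Dr_lt1 : D * r < 1).
Variables (U : set_system nat) (UU : UltraFilter U) (U_oo : \oo `<=` U).
Hypothesis nrm_ulim : forall (u : nat -> K) B, (forall k, nrm (u k) <= B) ->
  exists x, forall e, 0 < e -> U [set k | nrm (u k - x) < e].
Implicit Types (x y z w : K) (rho : R).

Definition unit_ball rho : set K := [set x | nrm (x - 1) <= rho].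

Lemma nrmN x : nrm (- x) = nrm x.
Proof.
have le y : nrm (- y) <= nrm y.
  by rewrite -sub0r; apply: le_trans (nrmB _ _) _; rewrite nrm0 ge_max nrm_ge0 lexx.
by apply/eqP; rewrite eq_le le -{1}[x]opprK le.
Qed.

Lemma nrmD x y : nrm (x + y) <= Num.max (nrm x) (nrm y).
Proof. by rewrite -{1}[y]opprK -(nrmN y). Qed.

Lemma nrmB_le rho x y : nrm x <= rho -> nrm y <= rho -> nrm (x - y) <= rho.
Proof. by move=> xr yr; apply: le_trans (nrmB _ _) _; rewrite ge_max xr. Qed.

Lemma nrmD_le rho x y : nrm x <= rho -> nrm y <= rho -> nrm (x + y) <= rho.
Proof. by move=> xr yr; apply: le_trans (nrmD _ _) _; rewrite ge_max xr. Qed.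

Lemma nrm_sum_le rho (I : Type) (s : seq I) (F : I -> K) : 0 <= rho ->
  (forall i, nrm (F i) <= rho) -> nrm (\sum_(i <- s) F i) <= rho.
Proof.
move=> rho0 Fr; elim/big_rec: _ => [|i x _ xr]; first by rewrite nrm0.
exact: nrmD_le.
Qed.

Lemma nrmM_le x y rho1 rho2 : nrm x <= rho1 -> nrm y <= rho2 ->
  nrm (x * y) <= D * rho1 * rho2.
Proof.
move=> xr yr; apply: le_trans (nrmM _ _) _.
have Dx : D * nrm x <= D * rho1 by rewrite ler_wpM2l ?(ltW D_gt0).
by apply: ler_pM => //; rewrite mulr_ge0 // ltW.
Qed.

Lemma unit_ball_le rho rho' x : rho <= rho' -> unit_ball rho x -> unit_ball rho' x.
Proof. by move=> rr' xr; exact: le_trans xr rr'. Qed.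

Lemma nrmM_unit x y : unit_ball r x -> nrm (y * x) <= nrm y.
Proof.
move=> xr; have -> : y * x = y + y * (x - 1) by ring.
apply: nrmD_le => //; apply: le_trans (nrmM_le (lexx _) xr) _.
by rewrite mulrAC ler_piMl // ltW.
Qed.

(** From 1 = 1 * 1 one gets [D * nrm 1 >= 1 > D * r], so 0 lies farther than [r] from 1. *)
Lemma unit_ball_neq0 x : unit_ball r x -> x != 0.
Proof.
move=> xr; apply/eqP => x0; move: xr; rewrite /unit_ball /= x0 sub0r nrmN => n1.
have n10 : 0 < nrm 1.
  by rewrite lt_def nrm_ge0 andbT; apply/eqP => /nrm_eq0 /eqP; rewrite oner_eq0.
have := nrmM 1 1; rewrite mulr1 ler_pMl // => D1.
have D2 : D * nrm 1 <= D * r by rewrite ler_pM2l.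
by have := le_lt_trans (le_trans D1 D2) Dr_lt1; rewrite ltxx.
Qed.

(** [y = x^-1 - 1] satisfies [y = - (x - 1) - (x - 1) * y]; if [nrm y] exceeded [rho], the last term
    would dominate, although its norm is below [nrm y]. *)
Lemma unit_ballV rho x : 0 <= rho <= r -> unit_ball rho x -> unit_ball rho x^-1.
Proof.
move=> /andP[rho0 rr] xr; have x0 := unit_ball_neq0 (unit_ball_le rr xr).
rewrite /unit_ball /= leNgt; apply/negP; set y := x^-1 - 1 => lt_rho.
have yE : y = - (x - 1) - (x - 1) * y by rewrite /y; field.
have y0 : 0 < nrm y by apply: le_lt_trans lt_rho.
have : nrm y <= Num.max rho (D * rho * nrm y).
  rewrite {1}yE; apply: le_trans (nrmB _ _) _.
  by rewrite ge_max !le_max nrmN xr /= (nrmM_le xr (lexx _)) orbT.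
rewrite le_max leNgt lt_rho /= ler_pMl // => Drho.
have D2 : D * rho <= D * r by rewrite ler_pM2l.
by have := le_lt_trans (le_trans Drho D2) Dr_lt1; rewrite ltxx.
Qed.

Lemma unit_ballM rho x y : 0 <= rho <= r ->
  unit_ball rho x -> unit_ball rho y -> unit_ball rho (x * y).
Proof.
move=> /andP[rho0 rr] xr yr; rewrite /unit_ball /=.
have -> : x * y - 1 = (x - 1) * y + (y - 1) by ring.
apply: nrmD_le => //; apply: le_trans (nrmM_unit _ _) xr.
exact: unit_ball_le yr.
Qed.

Lemma unit_ball1 rho : 0 <= rho -> unit_ball rho 1.
Proof. by move=> rho0; rewrite /unit_ball /= subrr nrm0. Qed.

Lemma unit_ball_div rho x y : unit_ball r y -> nrm (x - y) <= rho ->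
  unit_ball rho (x / y).
Proof.
move=> yr xy; have y0 := unit_ball_neq0 yr; rewrite /unit_ball /=.
have -> : x / y - 1 = (x - y) * y^-1 by field.
by apply: le_trans (nrmM_unit _ _) xy; apply: unit_ballV => //; rewrite lexx ltW.
Qed.

(* The approximations of x by values of Phi need not be coherent: any limit of
   them along the ultrafilter works. *)
Lemma successive_approximation (Phi : K -> K) (S : set K) :
    (forall x y, Phi (x * y) = Phi x * Phi y) -> (forall x, Phi x^-1 = (Phi x)^-1) ->
    (forall rho x, 0 <= rho <= r -> unit_ball rho x -> unit_ball rho (Phi x)) ->
    (forall rho x, 0 <= rho <= r -> S x -> unit_ball rho x ->
      exists y, [/\ unit_ball rho y, unit_ball (D * r * rho) (x / Phi y)
                  & S (x / Phi y)]) ->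
  forall x, S x -> unit_ball r x -> exists2 y, unit_ball r y & x = Phi y.
Proof.
move=> PhiM PhiV Phi_ball step x Sx xr.
have rr : 0 <= r <= r by rewrite lexx ltW.
have kap0 : 0 < D * r by rewrite mulr_gt0.
have pow_r k : 0 <= (D * r) ^+ k * r <= r.
  have k0 := ltW kap0; have r0 := ltW r_gt0.
  by rewrite mulr_ge0 ?exprn_ge0 //= ler_piMl // exprn_ile1 // ltW.
have Phi1 : Phi 1 = 1.
  have P0 : Phi 1 != 0.
    by apply: unit_ball_neq0; apply: Phi_ball => //; apply: unit_ball1; exact: ltW.
  by apply: (mulfI P0); rewrite -PhiM !mulr1.
have /choice[Y YP] k : exists y, [/\ unit_ball r y,
    unit_ball ((D * r) ^+ k * r) (x / Phi y) & S (x / Phi y)].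
  elim: k => [|k [y [yr xy Sxy]]].
    exists 1; rewrite Phi1 divr1 expr0 mul1r; split => //.
    by apply: unit_ball1; exact: ltW.
  have [y' [y'r xy' Sxy']] := step _ _ (pow_r k) Sxy xy.
  exists (y * y'); rewrite PhiM invfM mulrA exprS -mulrA; split => //.
  apply: unit_ballM => //; apply: unit_ball_le y'r.
  by have /andP[] := pow_r k.
have [|y yP] := @nrm_ulim Y (Num.max r (nrm 1)).
  move=> k; have [Yr _ _] := YP k; rewrite -[Y k](subrK 1).
  by apply: le_trans (nrmD _ _) _; rewrite ge_max !le_max Yr lexx orbT.
have yr : unit_ball r y.
  have [k /= kr] := filter_ex (yP r r_gt0); have [Yr _ _] := YP k.
  have -> : y = Y k - (Y k - y) by ring.
  rewrite /unit_ball /= addrAC; apply: nrmB_le => //; exact: ltW.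
exists y => //; have y0 := unit_ball_neq0 yr.
have Py0 : Phi y != 0 by apply: unit_ball_neq0; exact: Phi_ball.
suff z1 : x / Phi y = 1 by rewrite -[LHS](divfK Py0) z1 mul1r.
apply/eqP; rewrite -subr_eq0; apply/eqP/nrm_eq0/eqP.
rewrite eq_le nrm_ge0 andbT leNgt; apply/negP => z0.
(* The half yields the contradiction; the cap [r] keeps [eps] among the radii whose balls are
   groups. *)
pose eps := Num.min r (nrm (x / Phi y - 1) / 2).
have eps0 : 0 < eps by rewrite lt_min r_gt0 divr_gt0.
have [k0 k0P] : exists k0, forall k, (k0 <= k)%N -> (D * r) ^+ k * r <= eps.
  have k1 : 1 < (D * r)^-1 by rewrite invf_gt1.
  have [k0 k0P] := exp_unbounded (r / eps) k1; exists k0 => k k0k.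
  move: k0P; rewrite exprVn ltr_pdivrMr // mulrC ltr_pdivlMr ?exprn_gt0 // mulrC => k0P.
  apply: le_trans (ltW k0P); rewrite ler_wpM2r ?(ltW r_gt0) //.
  by rewrite ler_wiXn2l // ?(ltW kap0) ?(ltW Dr_lt1).
have [k [/= Yk /k0P kk0]] := filter_ex (filterI (yP _ eps0) (ultra_ge U_oo k0)).
have [Yr xY _] := YP k.
have epsr : 0 <= eps <= r by rewrite ltW //= ge_min lexx.
have PY0 : Phi (Y k) != 0 by apply: unit_ball_neq0; exact: Phi_ball.
have : unit_ball eps (x / Phi y).
  have -> : x / Phi y = (x / Phi (Y k)) * Phi (Y k / y).
    by rewrite PhiM PhiV mulrA divfK.
  apply: unit_ballM => //; first exact: unit_ball_le xY.
  by apply: Phi_ball => //; apply: unit_ball_div => //; exact: ltW.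
rewrite /unit_ball /= le_min => /andP[_]; lra.
Qed.

(* e_sum makes K an induced module over the group generated by tau. *)
Variables (tau : {rmorphism K -> K}) (t : nat) (e : {additive K -> K}).
Hypotheses (nrm_tau : forall x, nrm (tau x) <= nrm x).
Hypothesis tau_t : forall x, iter t tau x = x.
Hypotheses (nrm_e : forall x, nrm (e x) <= nrm x).
Hypothesis e_sum : forall z, \sum_(i < t) iter i tau (e (iter (t - i) tau z)) = z.

Definition iter_norm x := \prod_(i < t) iter i tau x.
Definition coboundary x := x / tau x.

Lemma iterM i x y : iter i tau (x * y) = iter i tau x * iter i tau y.
Proof. by elim: i => //= i ->; rewrite rmorphM. Qed.

Lemma iterV i x : iter i tau x^-1 = (iter i tau x)^-1.
Proof. by elim: i => //= i ->; rewrite fmorphV. Qed.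

Lemma iter_addr i x y : iter i tau (x + y) = iter i tau x + iter i tau y.
Proof. by elim: i => //= i ->; rewrite rmorphD. Qed.

Lemma iter_subr i x y : iter i tau (x - y) = iter i tau x - iter i tau y.
Proof. by elim: i => //= i ->; rewrite rmorphB. Qed.

Lemma iter_0 i : iter i tau 0 = 0.
Proof. by elim: i => //= i ->; rewrite rmorph0. Qed.

Lemma iter_1 i : iter i tau 1 = 1.
Proof. by elim: i => //= i ->; rewrite rmorph1. Qed.

Lemma iter_fix i x : tau x = x -> iter i tau x = x.
Proof. by move=> tx; elim: i => //= i ->. Qed.

Lemma nrm_iter i x : nrm (iter i tau x) <= nrm x.
Proof. by elim: i => //= i; apply: le_trans (nrm_tau _). Qed.

Lemma iter_normM x y : iter_norm (x * y) = iter_norm x * iter_norm y.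
Proof. by rewrite -big_split; apply: eq_bigr => i _; rewrite iterM. Qed.

Lemma iter_normV x : iter_norm x^-1 = (iter_norm x)^-1.
Proof. by rewrite -prodfV; apply: eq_bigr => i _; rewrite iterV. Qed.

Lemma iter_norm1 : iter_norm 1 = 1.
Proof. by rewrite /iter_norm big1 // => i _; rewrite iter_1. Qed.

Lemma iter_norm_tau x : tau (iter_norm x) = iter_norm x.
Proof.
rewrite /iter_norm rmorph_prod; case: t tau_t => [|n] tn; first by rewrite !big_ord0.
rewrite big_ord_recr big_ord_recl /= -iterS tn mulrC.
by congr (_ * _); apply: eq_bigr => i _; rewrite /= /bump leq0n add1n iterS.
Qed.

Lemma iter_norm_comm x : iter_norm (tau x) = iter_norm x.
Proof.
rewrite -[RHS]iter_norm_tau /iter_norm rmorph_prod.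
by apply: eq_bigr => i _; rewrite -iterSr.
Qed.

Lemma unit_ball_tau rho i x : unit_ball rho x -> unit_ball rho (iter i tau x).
Proof.
by rewrite /unit_ball /= => xr; rewrite -(iter_1 i) -iter_subr; apply: le_trans (nrm_iter _ _) xr.
Qed.

Lemma unit_ball_norm rho x : 0 <= rho <= r -> unit_ball rho x -> unit_ball rho (iter_norm x).
Proof.
move=> rr xr; have /andP[rho0 _] := rr.
rewrite /iter_norm; elim/big_rec: _ => [|i y _ yr]; first exact: unit_ball1.
by apply: unit_ballM => //; exact: unit_ball_tau.
Qed.

Lemma unit_ball_coboundary rho x : 0 <= rho <= r ->
  unit_ball rho x -> unit_ball rho (coboundary x).
Proof.
move=> rr xr; apply: unit_ballM => //; apply: unit_ballV => //.
exact: (unit_ball_tau 1).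
Qed.

(** To first order the norm is 1 plus the trace: each new factor adds the cross term
    [(P - 1) * iter k tau w], of norm at most [D * rho * rho]. *)
Lemma norm_linear_part rho w k : 0 <= rho <= r -> nrm w <= rho ->
  nrm (\prod_(i < k) iter i tau (1 + w) - 1 - \sum_(i < k) iter i tau w)
    <= D * r * rho.
Proof.
move=> rr wr; have /andP[rho0 rhor] := rr.
have kr0 : 0 <= D * r * rho by rewrite !mulr_ge0 ?(ltW D_gt0) ?(ltW r_gt0).
elim: k => [|k IH]; first by rewrite !big_ord0 subrr subr0 nrm0.
rewrite !big_ord_recr /=; set P := \prod_(i < k) _ in IH *; set S := \sum_(i < k) _ in IH *.
have -> : P * iter k tau (1 + w) - 1 - (S + iter k tau w) =
    (P - 1 - S) + (P - 1) * iter k tau w.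
  by rewrite iter_addr iter_1; ring.
apply: nrmD_le => //.
have Pr : unit_ball rho P.
  rewrite /P; elim/big_rec: _ => [|i y _ yr]; first exact: unit_ball1.
  apply: unit_ballM => //; apply: unit_ball_tau.
  by rewrite /unit_ball /= addrC addKr.
apply: le_trans (nrmM_le Pr (le_trans (nrm_iter _ _) wr)) _.
by rewrite ler_wpM2r // ler_wpM2l // ltW.
Qed.

(* This lemma and unit_ball_Hm1 are the vanishing of the Tate cohomology groups
   H^0 and H^-1 of the unit ball. *)
Lemma unit_ball_H0 x : tau x = x -> unit_ball r x ->
  exists2 y, unit_ball r y & x = iter_norm y.
Proof.
apply: (@successive_approximation iter_norm [set x | tau x = x]) => {x}.
- exact: iter_normM.
- exact: iter_normV.
- exact: unit_ball_norm.
move=> rho x rr /= tx xr; have /andP[rho0 rhor] := rr.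
(* As [x - 1] is fixed by [tau], [e_sum] says that [w] has trace [x - 1], so the norm of [1 + w]
   agrees with [x] to first order. *)
pose w := e (x - 1); have wr : nrm w <= rho by exact: le_trans (nrm_e _) xr.
have w1 : unit_ball rho (1 + w) by rewrite /unit_ball /= addrC addKr.
exists (1 + w); split=> //; last by rewrite rmorphM fmorphV iter_norm_tau tx.
have Nr := unit_ball_norm rr w1.
apply: unit_ball_div; first exact: unit_ball_le Nr.
have := norm_linear_part t rr wr; rewrite -/(iter_norm _).
have -> : \sum_(i < t) iter i tau w = x - 1.
  rewrite -[RHS]e_sum; apply: eq_bigr => i _.
  by rewrite (iter_fix (t - i)) // rmorphB rmorph1 tx.
by rewrite opprB addrA subrK -nrmN opprB.
Qed.

(** The induced structure gives an explicit solution built from the partial traces [S i].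
    Explicitness matters for the bound: no operation involved increases [nrm]. *)
Lemma additive_hilbert90 rho z : 0 <= rho -> nrm z <= rho ->
    \sum_(i < t) iter i tau z = 0 ->
  exists2 w, nrm w <= rho & z = w - tau w.
Proof.
move=> rho0 zr tr0.
pose S i := \sum_(j < i) iter j tau z.
pose E i y := iter i tau (e (iter (t - i) tau y)).
have Sr i : nrm (S i) <= rho.
  by apply: nrm_sum_le => // j; apply: le_trans (nrm_iter _ _) zr.
have Er i y : nrm (E i y) <= nrm y.
  by apply: le_trans (nrm_iter _ _) _; apply: le_trans (nrm_e _) (nrm_iter _ _).
have EB i x y : E i (x - y) = E i x - E i y.
  by rewrite /E iter_subr raddfB iter_subr.
have shift (a : nat -> K) : a t = a 0%N -> \sum_(i < t) a i.+1 = \sum_(i < t) a i.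
  case: (t) => [|n] an; first by rewrite !big_ord0.
  by rewrite big_ord_recr big_ord_recl /= an addrC.
exists (\sum_(i < t) E i (S i)).
  by apply: nrm_sum_le => // i; exact: le_trans (Er _ _) (Sr _).
(* [tau] carries [E i] to [E i.+1] and [S i] to [S i.+1 - z]. The sum then telescopes around the
   cycle, which closes because the full trace vanishes, and leaves the sum of all [E i z], which is
   [z]. *)
have -> : tau (\sum_(i < t) E i (S i)) = \sum_(i < t) (E i.+1 (S i.+1) - E i.+1 z).
  rewrite rmorph_sum; apply: eq_bigr => i _; rewrite -EB.
  have -> : S i.+1 - z = tau (S i).
    rewrite /S big_ord_recl /= addrAC subrr add0r rmorph_sum.
    by apply: eq_bigr.
  by rewrite /E -iterSr -[(t - i)%N]/(t - i)%N -subSn ?subSS.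
have a1 : E t (S t) = E 0%N (S 0%N).
  rewrite /S big_ord0 tr0 /E !iter_0 raddf0 iter_0 //.
have a2 : E t z = E 0%N z by rewrite /E subnn subn0 /= !tau_t.
rewrite sumrB (shift (fun i => E i (S i)) a1) (shift (fun i => E i z) a2).
by rewrite opprB addrCA subrr addr0 /E e_sum.
Qed.

Lemma unit_ball_Hm1 x : iter_norm x = 1 -> unit_ball r x ->
  exists2 y, unit_ball r y & x = coboundary y.
Proof.
apply: (@successive_approximation coboundary [set x | iter_norm x = 1]) => {x}.
- by move=> x y; rewrite /coboundary rmorphM invfM mulrACA.
- by move=> x; rewrite /coboundary fmorphV invfM.
- exact: unit_ball_coboundary.
move=> rho x rr /= Nx xr; have /andP[rho0 rhor] := rr.
have kr0 : 0 <= D * r * rho by rewrite !mulr_ge0 ?(ltW D_gt0) ?(ltW r_gt0).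
have kr1 : D * r * rho <= rho by rewrite ler_piMl // ltW.
pose z := x - 1; pose T := \sum_(i < t) iter i tau z.
have Tr : nrm T <= D * r * rho.
  have := norm_linear_part t rr xr; rewrite addrCA subrr addr0 -/(iter_norm x) Nx.
  by rewrite subrr sub0r nrmN.
have tT : tau T = T.
  rewrite /T rmorph_sum; case: (t) tau_t => [|n] tn; first by rewrite !big_ord0.
  rewrite big_ord_recr big_ord_recl /= -iterS tn addrC.
  by congr (_ + _); apply: eq_bigr => i _; rewrite /= /bump leq0n add1n iterS.
(* Norm 1 makes the trace [T] of [z] of second order only; subtracting [e T], which has trace [T],
   corrects it to 0 at no cost in precision. *)
pose z1 := z - e T.
have eT : nrm (e T) <= D * r * rho by exact: le_trans (nrm_e _) Tr.
have z1r : nrm z1 <= rho by apply: nrmB_le => //; exact: le_trans eT kr1.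
have [|w wr z1E] := additive_hilbert90 rho0 z1r.
  under eq_bigr do rewrite iter_subr.
  rewrite sumrB -/T -[X in X - _]e_sum; apply/eqP; rewrite subr_eq0; apply/eqP.
  by apply: eq_bigr => i _; rewrite (iter_fix (t - i)).
have w1 : unit_ball rho (1 + w) by rewrite /unit_ball /= addrC addKr.
have w0 := unit_ball_neq0 (unit_ball_le rhor w1).
have tw1 := unit_ball_tau 1 w1; rewrite /= rmorphD rmorph1 in tw1.
have tw0 := unit_ball_neq0 (unit_ball_le rhor tw1).
exists (1 + w); split=> //; last first.
  rewrite iter_normM iter_normV Nx /coboundary iter_normM iter_normV iter_norm_comm.
  by rewrite divff ?invr1 ?mulr1 // (unit_ball_neq0 (unit_ball_le rhor (unit_ball_norm rr w1))).
apply: unit_ball_div.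
  by apply: unit_ball_le (unit_ball_coboundary rr w1).
have -> : x - coboundary (1 + w) = e T + z1 * tau w / (1 + tau w).
  have -> : x = 1 + (e T + z1) by rewrite /z1 /z; ring.
  rewrite /coboundary rmorphD rmorph1.
  by move: tw0; rewrite z1E => tw0; field.
apply: nrmD_le => //; apply: le_trans (nrmM_unit _ _) _.
  apply: unit_ballV; first by rewrite lexx ltW.
  exact: unit_ball_le tw1.
apply: le_trans (nrmM_le z1r (le_trans (nrm_tau _) wr)) _.
by rewrite ler_wpM2r // ler_wpM2l // ltW.
Qed.


(** * The subgroup generated by [c] and a ball, and the resulting norm index *)

Variables (a : absolute_value R K) (c : K) (C : R).
Hypotheses (t_gt0 : (0 < t)%N) (c_neq0 : c != 0) (ac_gt1 : 1 < a c)
  (tau_c : tau c = c) (C_gt0 : 0 < C) (nrm_a : forall x, nrm x <= C * a x)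
  (a_unit : forall x, unit_ball r x -> a x = 1).
Hypothesis a_ulim : forall (u : nat -> K) B, (forall k, a (u k) <= B) ->
  exists x, forall eps, 0 < eps -> U [set k | a (u k - x) < eps].
Hypothesis hilbert90 : forall x, x != 0 -> iter_norm x = 1 ->
  exists2 y, y != 0 & x = coboundary y.

Definition scaled_units : set K :=
  [set x | exists (m : int) v, unit_ball r v /\ x = c ^ m * v].

Let rr : 0 <= r <= r. Proof. by rewrite lexx ltW. Qed.

Lemma scaled_units_mulgrp : mulgrp scaled_units.
Proof.
split.
- exists 0, 1; rewrite expr0z mul1r; split=> //; apply: unit_ball1; exact: ltW.
- move=> [m [v [vr /eqP]]]; rewrite eq_sym mulf_eq0 (negPf (expfz_neq0 _ c_neq0)) /=.
  by rewrite (negPf (unit_ball_neq0 vr)).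
- move=> _ _ [m [v [vr ->]]] [m' [v' [vr' ->]]]; exists (m - m'), (v / v'); split.
    by apply: unit_ballM => //; exact: unit_ballV.
  by rewrite expfzDr // invfM -invr_expz mulrACA.
Qed.

Lemma absvalXz m : a (c ^ m) = a c ^ m.
Proof. by case: m => n; rewrite ?NegzE -?invr_expz ?absvalV -!exprnP absvalX. Qed.

Lemma scaled_unit_exponent m m' v v' : unit_ball r v -> unit_ball r v' ->
  c ^ m * v = c ^ m' * v' -> m = m'.
Proof.
move=> vr vr' /(congr1 a); rewrite !absvalM (a_unit vr) (a_unit vr') !mulr1 !absvalXz.
by apply: ieexprIz; rewrite ?gt_eqF // (lt_trans ltr01).
Qed.

Lemma iter_norm_scaled m v : iter_norm (c ^ m * v) = c ^ (m * t%:Z) * iter_norm v.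
Proof.
rewrite iter_normM; congr (_ * _); rewrite /iter_norm.
under eq_bigr do rewrite iter_fix ?fmorphXz ?tau_c //.
by rewrite prodr_const card_ord -exprz_exp.
Qed.

Lemma coboundary_scaled m v : coboundary (c ^ m * v) = coboundary v.
Proof.
rewrite /coboundary rmorphM fmorphXz tau_c invfM mulrACA divff ?mul1r //.
exact: expfz_neq0.
Qed.

Lemma scale_exponent x : x != 0 -> exists m : int, 1 <= a (x * c ^ m) <= a c.
Proof.
move=> x0; have ax0 := absval_gt0 a x0; have ac0 : 0 < a c by apply: lt_trans ac_gt1.
have [j jP] := exp_unbounded (a x) ac_gt1.
have [l lP] := exp_unbounded (a x)^-1 ac_gt1.
have exP : exists k, 1 <= a x / a c ^+ j * a c ^+ k.
  exists (l + j)%N; rewrite exprD mulrA mulrAC divfK ?expf_neq0 ?gt_eqF //.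
  by rewrite mulrC -ler_pdivrMr // mul1r ltW.
case: (ex_minnP exP) => k kP k_min.
have k0 : (0 < k)%N.
  case: k kP {k_min} => //; rewrite expr0 mulr1 ler_pdivlMr ?exprn_gt0 // mul1r.
  by rewrite leNgt jP.
exists (k%:Z - j%:Z); rewrite absvalM absvalXz expfzDr ?gt_eqF // -invr_expz -!exprnP.
rewrite (mulrC (_ ^+ k)) mulrA kP /= leNgt; apply/negP => gt_ac.
have : 1 <= a x / a c ^+ j * a c ^+ k.-1.
  by rewrite -(ler_pM2r ac0) mul1r -[leRHS]mulrA -exprSr prednK // ltW.
by move/k_min; rewrite leqNgt ltn_predL k0.
Qed.

(** Otherwise there is a sequence of elements in distinct cosets. Powers of [c] bring it into the
    annulus between 1 and [a c]; two terms close to a limit [y != 0] then have a quotient in the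
    ball. *)
Lemma scaled_units_finite_index : finite_index (@nonzero K) scaled_units.
Proof.
have gB := scaled_units_mulgrp; have [B1 _ Bd] := gB.
apply: contrapT => not_fin.
have /choice[h hP] (s : seq K) : exists x, x != 0 /\
    forall y, y \in s -> y != 0 -> ~ scaled_units (x / y).
  apply: contrapT => no_x; apply: not_fin.
  pose P x y := (y != 0) && `[< scaled_units (x / y) >].
  have Phas x : x != 0 -> has (P x) s.
    move=> x0; apply: contrapT => /negP/hasPn xs; apply: no_x; exists x.
    by split=> // y /xs; rewrite negb_and => /orP[/negP//|/asboolPn].
  exists 'I_(size s).+1, (fun x => inord (find (P x) s)) => x y x0 y0 /=.
  move/(congr1 (@nat_of_ord _)); rewrite !inordK ?ltnS ?find_size // => xy.
  have /andP[z0 /asboolP xz] := nth_find 0 (Phas x x0).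
  have /andP[_ /asboolP yz] := nth_find 0 (Phas y y0).
  rewrite -xy in yz; set z := nth _ _ _ in xz yz z0.
  have -> : x / y = (x / z) / (y / z) by field; rewrite z0 y0.
  exact: Bd.
(* [L k] lists the first [k] terms, and the next one avoids all their cosets. *)
pose L k := iter k (fun s => h s :: s) [::].
pose x k := h (L k).
have x0 k : x k != 0 by case: (hP (L k)).
have xL k l : (k < l)%N -> x k \in L l.
  elim: l => // l IH; rewrite ltnS leq_eqVlt => /orP[/eqP ->|/IH xk].
    by rewrite /L iterS inE eqxx.
  by rewrite /L iterS inE xk orbT.
have /choice[m mP] k := scale_exponent (x0 k).
pose u k := x k * c ^ m k.
have [|y yP] := @a_ulim u (a c); first by move=> k; case/andP: (mP k).
have y0 : y != 0.
  apply/eqP => y0; have [k /=] := filter_ex (yP 1 ltr01).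
  by rewrite y0 subr0 ltNge; case/andP: (mP k) => ->.
have ay0 := absval_gt0 a y0.
have eps0 : 0 < r * a y / C by rewrite divr_gt0 // mulr_gt0.
have [k [l [kl [/= ky ly]]]] := ultra_ex2 UU U_oo (yP _ eps0).
have uy i : a (u i - y) < r * a y / C -> unit_ball r (u i / y).
  rewrite ltr_pdivlMr // mulrC => iy; rewrite /unit_ball /=.
  have -> : u i / y - 1 = (u i - y) / y by field.
  apply: le_trans (nrm_a _) _; rewrite absval_div mulrA ler_pdivrMr //.
  exact: ltW.
have [_ /(_ _ (xL _ _ kl) (x0 k)) []] := hP (L l).
exists (m k - m l), ((u l / y) / (u k / y)); split.
  by apply: unit_ballM; [|exact: uy|apply: unit_ballV => //; exact: uy].
have ck := expfz_neq0 (m k) c_neq0; have cl := expfz_neq0 (m l) c_neq0.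
have xk := x0 k; rewrite -/(x l) /u expfzDr // -invr_expz.
by field; rewrite ck cl y0 xk.
Qed.

(** Fixed elements are classified by the exponent of [c] modulo [t]: the norm multiplies exponents
    by [t], and fixed elements of the ball are norms by [unit_ball_H0]. *)
Lemma scaled_units_H0 :
  coset_index (kernel_of coboundary `&` scaled_units) (iter_norm @` scaled_units) t.
Proof.
have t0 : t%:Z != 0 by rewrite eqz_nat -lt0n.
have /choice[m mP] x : exists m : int, scaled_units x ->
    exists2 v, unit_ball r v & x = c ^ m * v.
  have [[m [v [vr ->]]]|nx] := pselect (scaled_units x); last by exists 0.
  by exists m => _; exists v.
have normP x y : coboundary x = 1 -> coboundary y = 1 ->
    scaled_units x -> scaled_units y ->
    (iter_norm @` scaled_units) (x / y) <-> (m x == m y %[mod t])%Z.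
  move=> gx gy Bx By; have [v vr xE] := mP x Bx; have [w wr yE] := mP y By.
  have vw : unit_ball r (v / w) by apply: unit_ballM => //; exact: unit_ballV.
  have xyE : x / y = c ^ (m x - m y) * (v / w).
    by rewrite {1}xE {1}yE expfzDr // invfM -invr_expz mulrACA.
  rewrite eqz_mod_dvd; split.
    move=> [_ [k [z [zr ->]]]]; rewrite iter_norm_scaled xyE => E.
    have Nz := unit_ball_norm rr zr.
    by rewrite -(scaled_unit_exponent Nz vw E) dvdz_mull.
  move=> /dvdzP[k kE].
  have fix_of z l : unit_ball r z -> coboundary (c ^ l * z) = 1 -> tau z = z.
    move=> zr; rewrite coboundary_scaled /coboundary => /divr1_eq.
    by [].
  have tv : tau v = v by apply: (fix_of v (m x)) => //; rewrite -xE.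
  have tw : tau w = w by apply: (fix_of w (m y)) => //; rewrite -yE.
  have [|z zr zE] := unit_ball_H0 _ vw; first by rewrite rmorphM fmorphV tv tw.
  exists (c ^ k * z); first by exists k, z.
  by rewrite iter_norm_scaled -zE -kE xyE.
have bound x : (`|(m x %% t)%Z| < t)%N.
  by rewrite -ltz_nat gez0_abs ?modz_ge0 // ltz_pmod.
exists 'I_t, (fun x => Ordinal (bound x)); split.
  move=> x y [[_ gx] Bx] [[_ gy] By]; rewrite normP //; split.
    move=> /(congr1 val) /= E; apply/eqP.
    by rewrite -[LHS]gez0_abs ?modz_ge0 // E gez0_abs ?modz_ge0.
  by move=> /eqP E; apply: val_inj; rewrite /= E.
rewrite -[RHS]card_ord -cardsT; apply: eq_card => i; rewrite !inE.
apply/asboolP; have ci0 := expfz_neq0 i%:Z c_neq0.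
have B1 : unit_ball r 1 by apply: unit_ball1; exact: ltW.
have Bci : scaled_units (c ^ i%:Z) by exists i%:Z, 1; rewrite mulr1.
exists (c ^ i%:Z).
  by split=> //; split=> //; rewrite /coboundary fmorphXz tau_c divff.
apply: val_inj => /=; have [v vr E] := mP _ Bci.
have <- := scaled_unit_exponent B1 vr (etrans (mulr1 _) E).
by rewrite modz_small ?absz_nat //= ltz_nat ltn_ord.
Qed.

(** [kernel_of coboundary] is the multiplicative group of the fixed field of [tau]. An element of
    [scaled_units] of norm 1 has exponent 0, so that Hilbert 90 there reduces to [unit_ball_Hm1]. *)
Lemma norm_index :
  coset_index (kernel_of coboundary) (iter_norm @` @nonzero K) t.
Proof.
have iter_neq0 i x : x != 0 -> iter i tau x != 0.
  by move=> x0; elim: i => //= i; rewrite fmorph_eq0.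
have N0 x : x != 0 -> iter_norm x != 0.
  by move=> x0; apply/prodf_neq0 => i _; exact: iter_neq0.
have g0 x : x != 0 -> coboundary x != 0.
  by move=> x0; rewrite mulf_neq0 // invr_eq0 fmorph_eq0.
apply: (herbrand_index N0 g0 _ _ _ _ hilbert90 scaled_units_mulgrp
         scaled_units_finite_index _ _ _ scaled_units_H0).
- by move=> x y; rewrite iter_normM iter_normV.
- by move=> x y; rewrite /coboundary rmorphM fmorphV !invfM invrK mulrACA.
- move=> x x0; rewrite /coboundary iter_normM iter_normV iter_norm_comm divff //.
  exact: N0.
- by move=> x x0; rewrite /coboundary iter_norm_tau divff // N0.
- move=> _ [m [v [vr ->]]]; rewrite iter_norm_scaled.
  by exists (m * t), (iter_norm v); split=> //; exact: unit_ball_norm.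
- move=> _ [m [v [vr ->]]]; rewrite coboundary_scaled.
  by exists 0, (coboundary v); rewrite expr0z mul1r; split=> //; exact: unit_ball_coboundary.
- move=> _ [m [v [vr ->]]]; rewrite iter_norm_scaled => N1.
  have Nv := unit_ball_norm rr vr.
  have B1 : unit_ball r 1 by apply: unit_ball1; exact: ltW.
  have /eqP : m * t = 0.
    by apply: (scaled_unit_exponent Nv B1); rewrite N1 expr0z mul1r.
  rewrite mulf_eq0 orbC -[t%:Z == 0]/(t == 0)%N (gtn_eqF t_gt0) /= => /eqP m0.
  move: N1; rewrite m0 mul0r !expr0z !mul1r => /unit_ball_Hm1 /(_ vr) [y yr ->].
  by exists y => //; exists 0, y; rewrite expr0z mul1r.
Qed.

End UnitFiltration.

(** * Roots of unity as norms *)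

Section IterNorm.
Variables (K : fieldType) (sigma : {rmorphism K -> K}).
Implicit Types x y : K.

Lemma iter_prod i (I : Type) (s : seq I) (G : I -> K) :
  iter i sigma (\prod_(j <- s) G j) = \prod_(j <- s) iter i sigma (G j).
Proof.
by elim: i => //= i ->; rewrite rmorph_prod.
Qed.

Lemma iter_normS k x :
  iter_norm sigma k.+1 x = iter_norm sigma k x * iter k sigma x.
Proof. by rewrite /iter_norm big_ord_recr. Qed.

Lemma iter_norm_add m k x :
  iter_norm sigma (m + k) x = iter_norm sigma m x * iter m sigma (iter_norm sigma k x).
Proof.
rewrite /iter_norm big_split_ord /= iter_prod; congr (_ * _).
by apply: eq_bigr => i _; rewrite iterD.
Qed.

(** Both sides are the product of [k + 1] conjugates, split at either end. For [k = p] it shows that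
    x is fixed by [tau] exactly when its partial norm is fixed by [sigma], if x is nonzero. *)
Lemma iter_norm_shift k x :
  sigma (iter_norm sigma k x) * x = iter_norm sigma k x * iter k sigma x.
Proof.
rewrite -iter_normS -[k.+1]add1n iter_norm_add mulrC.
by rewrite {2}/iter_norm big_ord1.
Qed.

Lemma iter_norm_morph k x : iter_norm sigma k (sigma x) = sigma (iter_norm sigma k x).
Proof.
rewrite /iter_norm rmorph_prod; by apply: eq_bigr => i _; rewrite -iterSr.
Qed.

Lemma iter_norm_fixed k x : sigma x = x -> iter_norm sigma k x = x ^+ k.
Proof.
move=> sx; rewrite /iter_norm; under eq_bigr do rewrite iter_fix //.
by rewrite prodr_const card_ord.
Qed.

Lemma iter_norm_neq0 k x : x != 0 -> iter_norm sigma k x != 0.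
Proof.
move=> x0; apply/prodf_neq0 => i _; elim: (nat_of_ord i) => //= j.
by rewrite fmorph_eq0.
Qed.

Variables (tau : {rmorphism K -> K}) (p : nat).
Hypothesis tauE : forall x, tau x = iter p sigma x.

Lemma iter_tau i x : iter i tau x = iter (p * i) sigma x.
Proof.
elim: i => [|i IH]; first by rewrite muln0.
by rewrite iterS IH tauE -iterD mulnS.
Qed.

(** Transitivity of norms. The product of [p] conjugates is the norm from M to F only on M, but the
    identity holds on all of K. *)
Lemma iter_norm_mul i x :
  iter_norm sigma (p * i) x = iter_norm tau i (iter_norm sigma p x).
Proof.
elim: i => [|i IH]; first by rewrite muln0 /iter_norm !big_ord0.
by rewrite mulnSr iter_norm_add IH -iter_tau [RHS]/iter_norm big_ord_recr.
Qed.

Lemma iter_norm_comm_tau i x : iter_norm tau i (iter_norm sigma p x) =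
  iter_norm sigma p (iter_norm tau i x).
Proof.
rewrite /iter_norm; under eq_bigr do rewrite iter_tau iter_prod.
under [RHS]eq_bigr do rewrite iter_prod.
rewrite exchange_big; apply: eq_bigr => j _; apply: eq_bigr => k _.
by rewrite iter_tau -!iterD addnC.
Qed.

End IterNorm.

Section RootOfUnityNorm.
Variables (K : fieldType) (sigma tau : {rmorphism K -> K}) (p n : nat).
Hypothesis p_pr : prime p.
Hypothesis tauE : forall x, tau x = iter p sigma x.
Let q := (p ^ n.+1)%N.
Let t := (p ^ n)%N.
Hypothesis sigma_q : forall x, iter q sigma x = x.
Hypothesis hilbert90_tau : forall x, x != 0 -> iter_norm tau t x = 1 ->
  exists2 y, y != 0 & x = coboundary tau y.
Hypothesis index_q :
  coset_index (kernel_of (coboundary sigma)) (iter_norm sigma q @` @nonzero K) q.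
Hypothesis index_t :
  coset_index (kernel_of (coboundary tau)) (iter_norm tau t @` @nonzero K) t.

Let qE : q = (p * t)%N. Proof. by rewrite /q expnS. Qed.

Let norm_q x : iter_norm sigma q x = iter_norm tau t (iter_norm sigma p x).
Proof. by rewrite qE (iter_norm_mul tauE). Qed.

Lemma kernel_coboundaryP (s : {rmorphism K -> K}) x :
  kernel_of (coboundary s) x <-> x != 0 /\ s x = x.
Proof.
rewrite /kernel_of /coboundary /=; split=> -[x0 sx]; split => //.
  by apply/esym/divr1_eq.
by rewrite sx divff.
Qed.

(* Injectivity of the inflation map from F^x/N(M^x) to F^x/N(K^x), which is the power
   map to the exponent [K : M] = t. *)
Lemma inflation_injective g z : g != 0 -> z != 0 -> sigma g = g ->
    g ^+ t = iter_norm sigma q z ->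
  exists2 y, kernel_of (coboundary tau) y & g = iter_norm sigma p y.
Proof.
move=> g0 z0 sg gz; have tg : tau g = g by rewrite tauE iter_fix.
have Nz0 := iter_norm_neq0 sigma p z0.
have [||w w0 wE] := @hilbert90_tau (g / iter_norm sigma p z).
- by rewrite mulf_neq0 ?invr_eq0.
- rewrite iter_normM iter_normV (iter_norm_fixed _ tg) gz norm_q divff //.
  exact: iter_norm_neq0.
(* The partial norm of [coboundary sigma w] is [w / tau w], exactly the defect between [g] and the
   partial norm of [z]. *)
pose y := z * coboundary sigma w.
have y0 : y != 0 by rewrite !mulf_neq0 ?invr_eq0 ?fmorph_eq0.
have Nw0 := iter_norm_neq0 sigma p w0.
have Ny : g = iter_norm sigma p y.
  rewrite /y /coboundary !iter_normM iter_normV iter_norm_morph.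
  have -> : iter_norm sigma p w / sigma (iter_norm sigma p w) = w / tau w.
    rewrite tauE; apply/eqP; rewrite eqr_div ?fmorph_eq0 //.
      by rewrite -iter_norm_shift mulrC.
    by rewrite -tauE fmorph_eq0.
  by rewrite -[w / tau w]/(coboundary tau w) -wE mulrC divfK.
exists y => //; apply/kernel_coboundaryP; split => //.
have := iter_norm_shift sigma p y; rewrite -Ny sg -tauE => E.
exact/esym/(mulfI g0).
Qed.

(** Otherwise the partial norm would induce a surjection from a group of order [t] onto one of order
    [q]. *)
Lemma exists_non_norm : exists g, [/\ g != 0, sigma g = g &
  forall y, kernel_of (coboundary tau) y -> g <> iter_norm sigma p y].
Proof.
apply: contrapT => no_g.
suff : (q <= t)%N by rewrite leq_exp2l ?prime_gt1 // ltnn.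
apply: (index_surj_leq (f := iter_norm sigma p) _ _ _ index_t index_q).
- move=> x /kernel_coboundaryP[x0 tx]; apply/kernel_coboundaryP.
  split; first exact: iter_norm_neq0.
  have := iter_norm_shift sigma p x; rewrite -tauE tx => /mulIf; exact.
- move=> x y _ _ [z z0 zE]; exists z => //.
  by rewrite norm_q (iter_norm_comm_tau tauE) zE iter_normM iter_normV.
- move=> g /kernel_coboundaryP[g0 sg]; apply: contrapT => no_y; apply: no_g.
  exists g; split=> // y ky gE; apply: no_y; exists y => //; rewrite -gE divff //.
  exists 1; first exact: oner_neq0.
  exact: iter_norm1.
Qed.

Lemma root_of_unity_norm xi : xi ^+ p = 1 -> sigma xi = xi ->
  exists2 z, z != 0 & iter_norm tau t z = xi.
Proof.
move=> xip sxi; have p_gt0 := prime_gt0 p_pr; have p_gt1 := prime_gt1 p_pr.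
have xi0 : xi != 0.
  by apply/eqP => xi0; move/eqP: xip; rewrite xi0 expr0n gtn_eqF // eq_sym oner_eq0.
have [g [g0 sg g_non]] := exists_non_norm.
pose N := iter_norm sigma q @` @nonzero K.
have gN : mulgrp N.
  apply: mulgrp_image (mulgrp_nonzero K); first by move=> x; exact: iter_norm_neq0.
  by move=> x y; rewrite iter_normM iter_normV.
have t0 : (0 < t)%N by rewrite expn_gt0 p_gt0.
have q0 : (0 < q)%N by rewrite expn_gt0 p_gt0.
have Ngq : N (g ^+ q) by exists g => //; exact: iter_norm_fixed.
have order_g k : N (g ^+ k) -> (q %| k)%N.
  move=> Nk; apply: contrapT => /negP ndvd.
  have k0 : (0 < k)%N by case: k ndvd {Nk}; rewrite ?dvdn0.
  have Nd : N (g ^+ gcdn k q).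
    case: (egcdnP q k0) => u v uv _.
    have -> : g ^+ gcdn k q = (g ^+ k) ^+ u / (g ^+ q) ^+ v.
      by rewrite -!exprM ![(_ * u)%N]mulnC ![(_ * v)%N]mulnC uv exprD mulrAC divff ?mul1r ?expf_neq0.
    by case: (gN) => _ _; apply; exact: mulgrpX.
  (* A proper divisor of the prime power [q] divides [t], which would make [g ^+ t] a norm. *)
  have /dvdnP[l lE] : (gcdn k q %| t)%N.
    have /(dvdn_pfactor _ _ p_pr)[m mn dE] : (gcdn k q %| q)%N by exact: dvdn_gcdr.
    rewrite dE dvdn_exp2l // -ltnS ltn_neqAle mn andbT.
    apply: contra ndvd => /eqP mE; rewrite -[q]/(p ^ n.+1)%N -mE -dE.
    exact: dvdn_gcdl.
  have [z z0 zE] : N (g ^+ t) by rewrite lE mulnC exprM; exact: mulgrpX.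
  by have [y ky gE] := inflation_injective g0 z0 sg (esym zE); exact: (g_non y ky).
have [T [r [rP cardr]]] := index_q.
have kg k : kernel_of (coboundary sigma) (g ^+ k).
  by apply/kernel_coboundaryP; rewrite expf_neq0 // rmorphXn sg.
pose h (i : 'I_q) := r (g ^+ i).
have h_inj : injective h.
  have le_case (i j : 'I_q) : (i <= j)%N -> h i = h j -> i = j.
    move=> ij /esym /(rP _ _ (kg _) (kg _)).
    rewrite -{1}(subnK ij) exprD mulfK ?expf_neq0 // => /order_g dv.
    apply/val_inj/eqP; rewrite eqn_leq ij -subn_eq0 /=.
    apply: contraLR dv => ne; rewrite gtnNdvd ?lt0n //.
    exact: leq_ltn_trans (leq_subr _ _) _.
  move=> i j hij; have [ij|/ltnW ji] := leqP i j; first exact: le_case.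
  by apply/esym/le_case.
have kxi : kernel_of (coboundary sigma) xi by apply/kernel_coboundaryP.
(* The [q] powers of [g] have distinct labels and there are only [q] labels, so the class of [xi] is
   one of them. *)
have : r xi \in [set h i | i in 'I_q]%SET.
  have /eqP -> : [set h i | i in 'I_q]%SET ==
      [set i | `[< exists2 x, kernel_of (coboundary sigma) x & r x = i >]]%SET.
    rewrite eqEcard cardr card_imset // card_ord leqnn andbT.
    apply/fintype.subsetP => _ /imsetP[i _ ->]; rewrite inE; apply/asboolP.
    by exists (g ^+ i).
  by rewrite inE; apply/asboolP; exists xi.
case/imsetP => i _ /(rP _ _ kxi (kg _))[z z0 zE].
have xiE : xi = g ^+ i * iter_norm sigma q z by rewrite zE mulrC divfK ?expf_neq0.
have : (t * p %| i * p)%N.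
  rewrite mulnC -qE; apply: order_g; rewrite exprM.
  have -> : (g ^+ i) ^+ p = (iter_norm sigma q z ^+ p)^-1.
    have Nz0 : iter_norm sigma q z ^+ p != 0 by rewrite expf_neq0 // iter_norm_neq0.
    by apply: (mulIf Nz0); rewrite -exprMn -xiE xip mulVf.
  by apply: mulgrpV => //; apply: mulgrpX => //; exists z.
rewrite dvdn_pmul2r // => /dvdnP[l lE].
exists (g ^+ l * iter_norm sigma p z).
  by rewrite mulf_neq0 ?expf_neq0 ?iter_norm_neq0.
rewrite iter_normM -norm_q xiE lE exprM; congr (_ * _).
by apply: iter_norm_fixed; rewrite rmorphXn tauE iter_fix.
Qed.

End RootOfUnityNorm.

(** * Archimedean fields *)

Section Archimedean.
Variables (R : realType) (K : fieldType) (a : absolute_value R K).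
Variables (U : set_system nat) (UU : UltraFilter U) (U_oo : \oo `<=` U).
Hypothesis a_ulim : forall (u : nat -> K) B, (forall k, a (u k) <= B) ->
  exists x, forall eps, 0 < eps -> U [set k | a (u k - x) < eps].
Hypothesis arch : exists m : nat, 1 < a m%:R.
Variables (tau : {rmorphism K -> K}) (C : R).
Hypotheses (C_gt0 : 0 < C) (a_tau : forall x, a (tau x) <= C * a x).
Variable p : nat.
Hypothesis p_gt0 : (0 < p)%N.
Implicit Types x y z w : K.

(** The root must be fixed by [tau] as well: a Kummer generator has its p-th power fixed without
    being fixed itself. *)
Definition fixed_power x := exists y, [/\ y != 0, tau y = y & x = y ^+ p].

Lemma fixed_powerM x y : fixed_power x -> fixed_power y -> fixed_power (x * y).
Proof.
move=> [u [u0 tu ->]] [v [v0 tv ->]]; exists (u * v).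
by rewrite mulf_neq0 // rmorphM tu tv exprMn.
Qed.

Lemma fixed_powerV x : fixed_power x -> fixed_power x^-1.
Proof.
move=> [u [u0 tu ->]]; exists u^-1.
by rewrite invr_eq0 u0 fmorphV tu exprVn.
Qed.

Lemma fixed_power1 : fixed_power 1.
Proof. by exists 1; rewrite oner_neq0 rmorph1 expr1n. Qed.

Lemma nat_neq0 n : (0 < n)%N -> n%:R != 0 :> K.
Proof.
move=> n0; apply/eqP => nz; have := arch_nat_ge1 arch n0.
by rewrite nz absval0 leNgt ltr01.
Qed.

Lemma absval_exp_linear k w : a w <= 1 ->
  a ((1 + w) ^+ k - 1 - k%:R * w) <= 4 ^+ k * a w ^+ 2.
Proof.
move=> w1; elim: k => [|k IH].
  by rewrite expr0 subrr mul0r subr0 absval0 mul1r sqr_ge0.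
have -> : (1 + w) ^+ k.+1 - 1 - k.+1%:R * w =
    (1 + w) * ((1 + w) ^+ k - 1 - k%:R * w) + k%:R * w ^+ 2.
  by rewrite exprS -natr1; ring.
apply: le_trans (absvalD _ _ _) _.
rewrite absvalM [a (k%:R * _)]absvalM (absvalX _ w 2).
have w2 : a (1 + w) <= 2.
  by apply: le_trans (absvalD _ _ _) _; rewrite absval1; have := w1; lra.
have k4 : a k%:R <= 2 * 4 ^+ k.
  apply: le_trans (absval_nat _ _) _; elim: (k) => [|i IHi]; first by rewrite expr0; lra.
  have i4 : 1 <= 4 ^+ i :> R by rewrite exprn_ege1 // ler1n.
  by rewrite exprS -natr1; move: IHi i4; lra.
have -> : 4 ^+ k.+1 * a w ^+ 2 = 2 * (4 ^+ k * a w ^+ 2) + 2 * 4 ^+ k * a w ^+ 2.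
  by rewrite exprS; ring.
by apply: lerD; [apply: ler_pM; rewrite ?absval_ge0|rewrite ler_wpM2r ?sqr_ge0].
Qed.

Lemma absval_subX k B x y : 1 <= B -> a x <= B -> a y <= B ->
  a (x ^+ k - y ^+ k) <= k%:R * B ^+ k * a (x - y).
Proof.
move=> B1 xB yB; have B0 : 0 <= B by apply: le_trans B1.
elim: k => [|k IH]; first by rewrite !expr0 subrr absval0 !mul0r.
have -> : x ^+ k.+1 - y ^+ k.+1 = x * (x ^+ k - y ^+ k) + (x - y) * y ^+ k.
  by rewrite !exprS; ring.
apply: le_trans (absvalD _ _ _) _; rewrite !absvalM.
have -> : k.+1%:R * B ^+ k.+1 * a (x - y) =
    B * (k%:R * B ^+ k * a (x - y)) + a (x - y) * B ^+ k.+1.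
  by rewrite exprS -natr1; ring.
apply: lerD; first by apply: ler_pM; rewrite ?absval_ge0.
rewrite ler_wpM2l ?absval_ge0 // absvalX exprS.
apply: le_trans (_ : B ^+ k <= _); first by rewrite lerXn2r ?nnegrE ?absval_ge0.
by rewrite ler_peMl ?exprn_ge0.
Qed.

(* Newton's iteration for the p-th root. *)
Lemma fixed_power_open : exists2 rho, 0 < rho <= 1 / 2 & forall x,
  tau x = x -> a (x - 1) <= rho -> fixed_power x.
Proof.
have H1 : 1 <= 8 ^+ p :> R by rewrite exprn_ege1 // ler1n.
(* For s = [a (z - 1)], the quadratic remainder costs [4 ^+ p * s ^+ 2] and division by
   [(1 + w) ^+ p] at most another [2 ^+ p]; the total is at most s / 2 once s is below [rho]. *)
pose rho : R := (2 * 8 ^+ p)^-1.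
have rho0 : 0 < rho by rewrite invr_gt0 mulr_gt0 //; lra.
have rho2 : rho <= 1 / 2 by rewrite div1r lef_pV2 ?posrE //; lra.
exists rho; first by rewrite rho0.
have step z : tau z = z -> a (z - 1) <= rho ->
    exists y, [/\ y != 0, tau y = y & a (z / y ^+ p - 1) <= a (z - 1) / 2].
  move=> tz; set s := a (z - 1) => sr.
  have s0 : 0 <= s by exact: absval_ge0.
  pose w := (z - 1) / p%:R.
  have ws : a w <= s.
    rewrite absval_div ler_pdivrMr ?absval_gt0 ?nat_neq0 //.
    by rewrite ler_peMr // arch_nat_ge1.
  have y2 : 1 / 2 <= a (1 + w).
    have := absvalD a (1 + w) (- w); rewrite addrK absval1 absvalN; lra.
  have y0 : 1 + w != 0.
    by apply/eqP => y0; move: y2; rewrite y0 absval0; lra.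
  exists (1 + w); split=> //.
    by rewrite rmorphD rmorph1 /w rmorphM fmorphV rmorph_nat rmorphB rmorph1 tz.
  have yp0 : (1 + w) ^+ p != 0 by rewrite expf_neq0.
  have -> : z / (1 + w) ^+ p - 1 = - ((1 + w) ^+ p - 1 - p%:R * w) / (1 + w) ^+ p.
    have -> : p%:R * w = z - 1 by rewrite /w mulrC divfK ?nat_neq0.
    by field.
  rewrite absval_div absvalN ler_pdivrMr ?absval_gt0 //.
  have w1 : a w <= 1 by lra.
  apply: le_trans (absval_exp_linear p w1) _.
  have : (1 / 2) ^+ p <= a ((1 + w) ^+ p).
    by rewrite absvalX lerXn2r ?nnegrE ?absval_ge0 //; lra.
  move=> yp; apply: le_trans (_ : s / 2 * (1 / 2) ^+ p <= _); last first.
    by rewrite ler_wpM2l // divr_ge0.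
  apply: le_trans (_ : 4 ^+ p * (s * rho) <= _).
    rewrite ler_wpM2l ?exprn_ge0 // expr2; apply: ler_pM; rewrite ?absval_ge0 //.
    exact: le_trans sr.
  have -> : 4 ^+ p * (s * rho) = s / 2 * (4 ^+ p / 8 ^+ p).
    by rewrite /rho; field; lra.
  by rewrite -expr_div_n; have -> : 4 / 8 = 1 / 2 :> R by field.
move=> x tx xr.
have xrk k : exists y, [/\ y != 0, tau y = y & a (x / y ^+ p - 1) <= rho / 2 ^+ k].
  elim: k => [|k [y [y0 ty yk]]].
    by exists 1; rewrite oner_neq0 rmorph1 expr1n expr0 !divr1.
  have [||u [u0 tu uk]] := step (x / y ^+ p).
  - by rewrite rmorphM fmorphV rmorphXn tx ty.
  - apply: le_trans yk _; rewrite ler_pdivrMr ?exprn_gt0 // ler_peMr ?(ltW rho0) //.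
    by rewrite exprn_ege1 // ler1n.
  exists (y * u); rewrite mulf_neq0 // rmorphM ty tu; split=> //.
  rewrite exprMn invfM mulrA; apply: le_trans uk _.
  by rewrite exprSr invfM mulrA ler_pM2r ?invr_gt0.
have [Y YP] := choice xrk.
have close k : a (x / Y k ^+ p - 1) <= rho.
  have [_ _ yk] := YP k; apply: le_trans yk _.
  rewrite ler_pdivrMr ?exprn_gt0 // ler_peMr ?(ltW rho0) //.
  by rewrite exprn_ege1 // ler1n.
have ax2 : a x <= 2.
  by rewrite -[x](subrK 1); apply: le_trans (absvalD _ _ _) _; rewrite absval1; move: xr; lra.
have Yp k : a (Y k) ^+ p <= 4.
  have [y0 _ _] := YP k.
  have := close k; set v := x / _; move=> vr.
  have v2 : 1 / 2 <= a v.
    have := absvalD a v (1 - v); rewrite addrC subrK absval1 absval_distC; lra.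
  have vE : a v * a (Y k) ^+ p = a x by rewrite -absvalX -absvalM divfK ?expf_neq0.
  have : 1 / 2 * a (Y k) ^+ p <= a x by rewrite -vE ler_wpM2r ?exprn_ge0 ?absval_ge0.
  lra.
have Y4 k : a (Y k) <= 4.
  rewrite leNgt; apply/negP => gt4; have Y1 : 1 <= a (Y k) by move: gt4; lra.
  have : a (Y k) <= a (Y k) ^+ p.
    by rewrite -(prednK p_gt0) exprS ler_peMr ?absval_ge0 // exprn_ege1.
  by move/le_trans/(_ (Yp k)); rewrite leNgt gt4.
have [y yP] := a_ulim Y4.
have y4 : a y <= 5.
  have [k /= kY] := filter_ex (yP 1 ltr01).
  have := absvalD a (Y k) (y - Y k); rewrite addrC subrK absval_distC => yY.
  have := Y4 k; lra.
have yx : x = y ^+ p.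
  apply/eqP; rewrite -subr_eq0; apply/eqP/(@absval_eq0 _ _ a)/eqP.
  rewrite eq_le absval_ge0 andbT leNgt; apply/negP; set d := a _ => d0.
  pose M : R := p%:R * 5 ^+ p + 1.
  have M0 : 0 < M by rewrite ltr_wpDl // mulr_ge0 ?exprn_ge0.
  have e0 : 0 < d / 2 / M by rewrite !divr_gt0.
  have e1 : 0 < d / 2 / 4 by rewrite !divr_gt0.
  have [k [/= kY kd]] := filter_ex (filterI (yP _ e0) (ultra_lt_inv UU U_oo e1)).
  have [y0 _ xY] := YP k.
  have E1 : a (Y k ^+ p - y ^+ p) < d / 2.
    apply: le_lt_trans (absval_subX p (_ : 1 <= 5) _ y4) _; first by lra.
      by apply: le_trans (Y4 k) _; lra.
    apply: le_lt_trans (_ : M * a (Y k - y) < _).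
      by rewrite ler_wpM2r ?absval_ge0 // /M lerDl.
    by rewrite mulrC -ltr_pdivlMr.
  have E2 : a (x - Y k ^+ p) <= d / 2.
    have -> : x - Y k ^+ p = (x / Y k ^+ p - 1) * Y k ^+ p.
      by rewrite mulrBl divfK ?mul1r // expf_neq0.
    rewrite absvalM absvalX.
    apply: le_trans (_ : (d / 2 / 4) * 4 <= _); last by rewrite divfK // lt0r_neq0.
    apply: ler_pM; rewrite ?absval_ge0 ?exprn_ge0 ?absval_ge0 //.
    apply: le_trans xY _; apply: le_trans (ltW kd).
    have -> : k.+1%:R^-1 = 1 / k.+1%:R :> R by rewrite div1r.
    rewrite ler_pdivrMr ?exprn_gt0 // mulrAC ler_pdivlMr //.
    have k2 : k.+1%:R <= 2 ^+ k :> R by rewrite -natrX ler_nat ltn_expl.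
    by apply: ler_pM; rewrite ?(ltW rho0) ?ler0n //; lra.
  have := absvalD a (x - Y k ^+ p) (Y k ^+ p - y ^+ p); rewrite addrA subrK -/d.
  by rewrite leNgt => /negP; apply; lra.
exists y; split=> //.
  apply/eqP => y0; have := xr; rewrite yx y0 expr0n gtn_eqF // sub0r absvalN absval1.
  by rewrite leNgt => /negP; apply; lra.
(* The limit is fixed because [a_tau] makes [tau] continuous and every [Y k] is fixed. *)
apply/eqP; rewrite -subr_eq0; apply/eqP/(@absval_eq0 _ _ a)/eqP.
rewrite eq_le absval_ge0 andbT leNgt; apply/negP; set d := a _ => d0.
have C1 : 0 < C + 1 by rewrite addr_gt0.
have e0 : 0 < d / (C + 1) by rewrite divr_gt0.
have [k /= kY] := filter_ex (yP _ e0).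
have [_ tY _] := YP k.
have : d <= a (tau (y - Y k)) + a (Y k - y).
  have -> : d = a (tau (y - Y k) + (Y k - y)).
    by congr (a _); rewrite rmorphB tY addrA subrK.
  exact: absvalD.
have := a_tau (y - Y k); rewrite (absval_distC a y) => T1 T2.
move: kY; rewrite ltr_pdivlMr //; apply/negP; rewrite -leNgt.
by apply: le_trans T2 _; rewrite mulrDr mulr1 mulrC lerD2r.
Qed.

(** For large [N] the ratios [(N + i + 1) / (N + i)] are close to 1; their product from [N] up to
    [N * j] is [j]. *)
Lemma fixed_power_nat j : (0 < j)%N -> fixed_power j%:R.
Proof.
have [rho /andP[rho0 rho2] openP] := fixed_power_open.
have [N N0 NP] := arch_nat_unbounded arch rho^-1.
have ratio i : fixed_power ((N + i)%:R / N%:R).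
  elim: i => [|i IH]; first by rewrite addn0 divff ?nat_neq0 //; exact: fixed_power1.
  have Ni : (N + i)%:R != 0 :> K by rewrite nat_neq0 // addn_gt0 N0.
  have N0' := nat_neq0 N0.
  have -> : (N + i.+1)%:R / N%:R = ((N + i.+1)%:R / (N + i)%:R) * ((N + i)%:R / N%:R) :> K.
    by rewrite mulrA divfK.
  apply: fixed_powerM => //; apply: openP; first by rewrite rmorphM fmorphV !rmorph_nat.
  have -> : (N + i.+1)%:R / (N + i)%:R - 1 = (N + i)%:R^-1 :> K.
    by rewrite addnS -natr1 mulrDl divff // addrAC subrr add0r mul1r.
  rewrite absvalV -[rho]invrK lef_pV2 ?posrE ?invr_gt0 ?absval_gt0 //.
  by apply/ltW/NP; exact: leq_addr.
move=> j0; have := ratio (N * j - N)%N.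
by rewrite subnKC ?leq_pmulr // natrM mulrAC divff ?nat_neq0 // mul1r.
Qed.

(* Follow the segment from 1 to x in small rational steps: the class modulo
   p-th powers can only change near 0, in which case x is close to a negative
   rational number. *)
Lemma fixed_power_or_opp x : x != 0 -> tau x = x ->
  fixed_power x \/ fixed_power (- x).
Proof.
move=> x0 tx; have [Px|nPx] := pselect (fixed_power x); [by left|right].
have [rho /andP[rho0 rho2] openP] := fixed_power_open.
have x1 : x - 1 != 0.
  by rewrite subr_eq0; apply/eqP => x1; apply: nPx; rewrite x1; exact: fixed_power1.
have ax := absval_gt0 a x0; have ax1 := absval_gt0 a x1.
pose beta := a x / 2 / a (x - 1).
have beta0 : 0 < beta by rewrite !divr_gt0.
(* The three bounds serve in turn to exclude [j = 0], where [y j = 1]; to give [beta <= a s]; and to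
   make [y j / s] at most [rho]. *)
pose del := Num.min (1 / 2) (Num.min (a x / 2) (rho * beta)).
have del0 : 0 < del.
  rewrite !lt_min (mulr_gt0 rho0 beta0) andbT; apply/andP; split; first lra.
  by move: ax; lra.
have [del1 del2 del3] : [/\ del <= 1 / 2, del <= a x / 2 & del <= rho * beta].
  by split; rewrite /del !ge_min lexx ?orbT.
have [N N0 NP] := arch_nat_unbounded arch (a (x - 1) / (del * rho)).
have {}NP := NP N (leqnn _).
have Nn0 := nat_neq0 N0; have aN := absval_gt0 a Nn0.
pose y j := 1 + j%:R / N%:R * (x - 1).
have ty j : tau (y j) = y j.
  by rewrite /y rmorphD rmorph1 !rmorphM rmorphB rmorph1 fmorphV !rmorph_nat tx.
have [j [jN yj]] : exists j, (j <= N)%N /\ a (y j) < del.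
  apply: contrapT => no_j; apply: nPx.
  have far j : (j <= N)%N -> del <= a (y j).
    by move=> jN; rewrite leNgt; apply/negP => yj; apply: no_j; exists j.
  suff : fixed_power (y N) by rewrite /y divff // mul1r addrC subrK.
  have : (N <= N)%N by []; elim: {1 3}N => [|j IH] jN.
    by rewrite /y !mul0r addr0; exact: fixed_power1.
  have fj := far j (ltnW jN).
  have yj0 : y j != 0.
    by apply/eqP => yj0; move: fj; rewrite yj0 absval0 leNgt del0.
  rewrite -(divfK yj0 (y j.+1)); apply: fixed_powerM; last exact/IH/ltnW.
  apply: openP; first by rewrite rmorphM fmorphV !ty.
  have -> : y j.+1 / y j - 1 = (x - 1) / N%:R / y j.
    transitivity ((y j.+1 - y j) / y j); first by rewrite mulrBl divff.
    by congr (_ / _); rewrite /y -natr1; ring.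
  have ayj : 0 < a (y j) by exact: absval_gt0.
  rewrite !absval_div ler_pdivrMr // ler_pdivrMr //.
  apply: le_trans (_ : rho * del * a N%:R <= _).
    by move: NP; rewrite ltr_pdivrMr ?mulr_gt0 // => /ltW NP; rewrite mulrC (mulrC rho).
  by rewrite ler_wpM2r ?(ltW aN) // ler_wpM2l ?(ltW rho0).
have j0 : (0 < j)%N.
  case: j yj {jN} => //; rewrite /y !mul0r addr0 absval1 => yj.
  by have := lt_le_trans yj del1; rewrite ltNge => /negP; case; lra.
pose s : K := (N - j)%:R / N%:R.
have sE : s = 1 - j%:R / N%:R by rewrite /s natrB // mulrBl divff.
have s_beta : beta <= a s.
  rewrite /beta ler_pdivrMr // -absvalM.
  have -> : s * (x - 1) = x - y j by rewrite sE /y; ring.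
  have := absvalD a (x - y j) (y j); rewrite subrK => H.
  by have := lt_le_trans yj del2; move: H; lra.
have s0 : s != 0 by apply/eqP => s0; move: s_beta; rewrite s0 absval0 leNgt beta0.
have jN' : (0 < N - j)%N.
  by rewrite lt0n; apply/eqP => jN'; move: s0; rewrite /s jN' mul0r eqxx.
have jn0 := nat_neq0 j0; have jNn0 := nat_neq0 jN'.
(* As [y j = s + j / N * x] is small, [- x * (j / N) / s] is close to 1; the remaining factor is
   rational. *)
have -> : - x = (- x * (j%:R / N%:R) / s) * (N - j)%:R * j%:R^-1.
  by rewrite /s; field; rewrite jNn0 jn0 Nn0.
apply: fixed_powerM; last exact/fixed_powerV/fixed_power_nat.
apply: fixed_powerM; last exact: fixed_power_nat.
apply: openP.
  by rewrite !rmorphM rmorphN !fmorphV /s !rmorphM !fmorphV !rmorph_nat tx.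
have -> : - x * (j%:R / N%:R) / s - 1 = - y j / s.
  transitivity ((- x * (j%:R / N%:R) - s) / s); first by rewrite mulrBl divff.
  by congr (_ / _); rewrite sE /y; ring.
rewrite absval_div absvalN ler_pdivrMr ?absval_gt0 //.
apply: le_trans (ltW yj) _; apply: le_trans del3 _.
by rewrite ler_wpM2l // ltW.
Qed.

End Archimedean.

(** * Norm indices in the nonarchimedean case *)

(** Modulo [q], the shift is by [- s * i]: it brings [k] into the first block exactly when [k] lies
    in block number [i]. *)
Lemma shifted_block (s t q k i : nat) : q = (s * t)%N -> (0 < s)%N ->
    (k < q)%N -> (i < t)%N ->
  ((s * (t - i) + k) %% q < s)%N = (i == k %/ s)%N.
Proof.
move=> -> s0 kq it.
have le_it : (s * i <= s * t)%N by rewrite leq_mul2l (ltnW it) orbT.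
have le_s : (s * i + s <= s * t)%N by rewrite -mulnSr leq_mul2l it orbT.
have E : (s * (t - i) + k = s * t + k - s * i)%N by rewrite mulnBr; lia.
have [le_ik|lt_ki] := leqP (s * i) k.
  have -> : ((s * (t - i) + k) %% (s * t) = k - s * i)%N.
    by rewrite E -addnBA // modnDl modn_small // (leq_ltn_trans (leq_subr _ _)).
  rewrite eqn_leq leq_divRL // (mulnC i) le_ik /= -[RHS]ltnS ltn_divLR //.
  by rewrite mulSn mulnC; lia.
rewrite modn_small; last by rewrite E; lia.
have -> : (i == k %/ s)%N = false.
  by rewrite gtn_eqF // ltn_divLR // mulnC.
by rewrite E; lia.
Qed.

Section NormalBasisNorm.
Variables (R : realType) (F : fieldType) (K : fieldExtType F).
Variables (aF : absolute_value R F) (aK : absolute_value R K).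
Hypotheses (F_local : local_field aF) (K_local : local_field aK).
Hypothesis aK_extends_aF : forall x : F, aK x%:A = aF x.
Hypothesis nonarch : forall n : nat, aF n%:R <= 1.
Variables (sigma : {lrmorphism K -> K}) (theta : K) (q : nat).
Let bas i := iter i sigma theta.
Hypotheses (dimK : \dim {:K} = q) (q_gt0 : (0 < q)%N).
Hypothesis sigma_q : forall x, iter q sigma x = x.
Hypothesis bas_free : forall c : 'I_q -> F,
  \sum_i c i *: bas i = 0 -> forall i, c i = 0.
Implicit Types (x y z : K) (rho : R).

Let X : q.-tuple K := [tuple bas i | i < q].

Let XE (i : 'I_q) : X`_i = bas i.
Proof. by rewrite -tnth_nth tnth_mktuple. Qed.

Let X_free : free X.
Proof.
apply/freeP => k kX; apply: bas_free; rewrite -[RHS]kX.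
by apply: eq_bigr => i _; rewrite XE.
Qed.

Definition crd x (i : 'I_q) : F := coord X i x.

Lemma crdE x : x = \sum_i crd x i *: bas i.
Proof.
have X_basis : basis_of {:K} X.
  by rewrite basisEfree X_free subvf size_tuple dimK /=.
rewrite {1}(coord_basis X_basis (memvf x)).
by apply: eq_bigr => i _; rewrite XE.
Qed.

Lemma crd_uniq (c : 'I_q -> F) i : crd (\sum_j c j *: bas j) i = c i.
Proof.
rewrite /crd linear_sum (bigD1 i) //= linearZ /= -XE coord_free // eqxx mulr1.
rewrite big1 ?addr0 // => j ji; rewrite linearZ /= -XE coord_free //.
by rewrite (negPf ji) mulr0.
Qed.

(** Unlike [aK], this norm is visibly invariant under [sigma], which permutes the coordinates
    cyclically; it is multiplicative only up to a constant. *)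
Definition crd_norm x : R := \big[Order.max/0]_(i < q) aF (crd x i).

Lemma crd_norm_leP x rho : 0 <= rho ->
  reflect (forall i, aF (crd x i) <= rho) (crd_norm x <= rho).
Proof.
move=> rho0; apply: (iffP (bigmax_leP _ _ _ _)) => [[_ H] i|H]; first exact: H.
by split=> // i _; exact: H.
Qed.

Lemma le_crd_norm x i : aF (crd x i) <= crd_norm x.
Proof. exact: (le_bigmax 0 (fun i => aF (crd x i)) i). Qed.

Lemma crd_norm_ge0 x : 0 <= crd_norm x.
Proof. by apply: le_trans (le_crd_norm x (Ordinal q_gt0)); exact: absval_ge0. Qed.

Lemma crd_norm_eq0 x : crd_norm x = 0 -> x = 0.
Proof.
move=> x0; rewrite [x]crdE big1 // => i _.
suff -> : crd x i = 0 by rewrite scale0r.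
apply: (@absval_eq0 _ _ aF); apply/eqP; rewrite eq_le absval_ge0 andbT -x0.
exact: le_crd_norm.
Qed.

Lemma crd_norm0 : crd_norm 0 = 0.
Proof.
apply/eqP; rewrite eq_le crd_norm_ge0 andbT; apply/crd_norm_leP => // i.
by rewrite /crd linear0 absval0.
Qed.

Lemma crd_normB x y : crd_norm (x - y) <= Num.max (crd_norm x) (crd_norm y).
Proof.
apply/crd_norm_leP; first by rewrite le_max crd_norm_ge0.
move=> i; rewrite /crd linearB.
apply: le_trans (ultrametric_of_nat nonarch _ _) _; rewrite absvalN.
by rewrite ge_max !le_max !le_crd_norm orbT.
Qed.

Lemma crd_sigma x i : crd (sigma x) (ordS i) = crd x i.
Proof.
rewrite {1}[x]crdE linear_sum.
have E : \sum_(j < q) sigma (crd x j *: bas j) =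
    \sum_(j < q) crd x (ord_pred j) *: bas j.
  rewrite [RHS](reindex_inj (@ordS_inj q)) /=; apply: eq_bigr => j _.
  rewrite linearZ /= ordSK; congr (_ *: _); rewrite /bas -iterS /=.
  have [jq|] := ltnP j.+1 q; first by rewrite modn_small.
  move=> qj; have jq : j.+1 = q by apply/eqP; rewrite eqn_leq qj ltn_ord.
  by rewrite jq modnn /= -iterS jq sigma_q.
by rewrite E crd_uniq ordSK.
Qed.

Lemma crd_norm_sigma x : crd_norm (sigma x) <= crd_norm x.
Proof.
apply/crd_norm_leP => [|i]; first exact: crd_norm_ge0.
by rewrite -[i]ord_predK crd_sigma le_crd_norm.
Qed.

Variables (s t : nat) (tau : {lrmorphism K -> K}).
Hypotheses (qE : q = (s * t)%N) (tauE : forall x, tau x = iter s sigma x).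

(* K is induced from the span of the first s basis vectors: this is the
   projection onto it. *)
Definition block x : K := \sum_(j < q | (j < s)%N) crd x j *: bas j.

Lemma block_is_linear : linear block.
Proof.
move=> c x y; rewrite /block scaler_sumr -big_split /=; apply: eq_bigr => j _.
by rewrite /crd linearP scalerDl scalerA.
Qed.

HB.instance Definition _ := GRing.isLinear.Build F K K _ block block_is_linear.

Lemma crd_norm_block x : crd_norm (block x) <= crd_norm x.
Proof.
apply/crd_norm_leP => [|i]; first exact: crd_norm_ge0.
rewrite /block big_mkcond /=.
have -> : \sum_(j < q) (if (j < s)%N then crd x j *: bas j else 0) =
    \sum_(j < q) (if (j < s)%N then crd x j else 0) *: bas j.
  by apply: eq_bigr => j _; case: ifP; rewrite ?scale0r.
rewrite crd_uniq; case: ifP => _; first exact: le_crd_norm.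
by rewrite absval0 crd_norm_ge0.
Qed.

Lemma bas_mod m : bas m = bas (m %% q).
Proof.
rewrite {1}(divn_eq m q) /bas addnC iterD; congr (iter _ _ _).
elim: (m %/ q)%N => [|k IH]; first by rewrite mul0n.
by rewrite mulSn iterD IH sigma_q.
Qed.

Lemma block_bas m : block (bas m) = if (m %% q < s)%N then bas m else 0.
Proof.
have mq : (m %% q < q)%N by rewrite ltn_mod.
have crdm j : crd (bas m) j = (j == Ordinal mq)%:R.
  have -> : bas m = \sum_(i < q) (i == Ordinal mq)%:R *: bas i.
    rewrite (bigD1 (Ordinal mq)) //= eqxx scale1r big1 ?addr0; first exact: bas_mod.
    by move=> i /negPf ->; rewrite scale0r.
  by rewrite crd_uniq.
rewrite /block; under eq_bigr do rewrite crdm.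
case: ifP => ms.
  rewrite (bigD1 (Ordinal mq)) //= eqxx scale1r -bas_mod big1 ?addr0 //.
  by move=> i /andP[_ /negPf ->]; rewrite scale0r.
rewrite big1 // => i is_; case: eqP => [iE|_]; last by rewrite scale0r.
by move: is_; rewrite iE /= ms.
Qed.

Let iter_tauE i x : iter i tau x = iter (s * i) sigma x.
Proof. exact: iter_tau tauE i x. Qed.

(** By [shifted_block], each basis vector survives in exactly one of the [t] translated
    projections. *)
Lemma block_sum z : \sum_(i < t) iter i tau (block (iter (t - i) tau z)) = z.
Proof.
have s_gt0 : (0 < s)%N by move: q_gt0; rewrite qE muln_gt0 => /andP[].
have iter_lin i (c : 'I_q -> F) (G : 'I_q -> K) :
    iter i tau (\sum_j c j *: G j) = \sum_j c j *: iter i tau (G j).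
  elim: i => //= i ->; rewrite linear_sum.
  by apply: eq_bigr => j _; rewrite linearZ.
rewrite [RHS]crdE.
under eq_bigr => i _.
  rewrite {1}[z]crdE iter_lin linear_sum.
  under eq_bigr do rewrite linearZ /=.
  rewrite iter_lin.
  over.
rewrite exchange_big; apply: eq_bigr => k _ /=.
rewrite -scaler_sumr; congr (_ *: _).
have kt : (k %/ s < t)%N by rewrite ltn_divLR // mulnC -qE ltn_ord.
have moveE i : (i < t)%N -> (s * i + (s * (t - i) + k) = q + k)%N.
  by move=> it; rewrite addnA -mulnDr subnKC ?(ltnW it) // -qE.
have in_block (i : 'I_t) : ((s * (t - i) + k) %% q < s)%N = (nat_of_ord i == k %/ s)%N.
  by rewrite (shifted_block qE) // s_gt0.
rewrite (bigD1 (Ordinal kt)) //= big1 ?addr0 => [|i ik].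
  rewrite !iter_tauE /bas -iterD -/(bas _) block_bas (in_block (Ordinal kt)) eqxx.
  by rewrite /bas -iterD moveE // iterD sigma_q.
rewrite !iter_tauE /bas -iterD -/(bas _) block_bas in_block.
rewrite -[_ == _]/(i == Ordinal kt) (negPf ik).
by elim: (s * i)%N => //= j ->; rewrite linear0.
Qed.

Lemma nonarch_norm_index :
    (forall x, x != 0 -> iter_norm tau t x = 1 ->
      exists2 y, y != 0 & x = coboundary tau y) ->
  coset_index (kernel_of (coboundary tau)) (iter_norm tau t @` @nonzero K) t.
Proof.
move=> hilbert90; have [U [UU Uoo]] := exists_ultrafilter.
have [C C0 crd_le] := coord_bound F_local aK_extends_aF bas_free.
pose E := \sum_(i < q) aK (bas i) + 1.
have E0 : 0 < E by rewrite ltr_wpDl // sumr_ge0 // => i _; rewrite absval_ge0.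
have nrm_aK x : crd_norm x <= C * aK x.
  apply/crd_norm_leP => [|i]; first by rewrite mulr_ge0 ?(ltW C0) ?absval_ge0.
  by have := crd_le (crd x) i; rewrite -crdE.
have aK_nrm x : aK x <= E * crd_norm x.
  rewrite {1}[x]crdE; apply: le_trans (absval_sum _ _ _ _) _.
  rewrite mulrDl mul1r mulr_suml -[leLHS]addr0 lerD ?crd_norm_ge0 //.
  apply: ler_sum => i _; rewrite (absvalZ aK_extends_aF) mulrC.
  by rewrite ler_wpM2l ?absval_ge0 ?le_crd_norm //.
(* Products pass through [aK]: [E] twice for the two factors, [C] once to come back. *)
pose D := C * (E * E).
have D0 : 0 < D by rewrite !mulr_gt0.
have nrmM x y : crd_norm (x * y) <= D * crd_norm x * crd_norm y.
  apply: le_trans (nrm_aK _) _; rewrite /D absvalM -!mulrA ler_wpM2l ?(ltW C0) //.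
  have -> : E * (E * (crd_norm x * crd_norm y)) = (E * crd_norm x) * (E * crd_norm y).
    by ring.
  by apply: ler_pM; rewrite ?absval_ge0.
(* [D * r < 1] drives the approximations; [E * r < 1] forces [aK x = 1] on the ball by the
   ultrametric inequality. *)
pose r := (D + E + 1)^-1.
have DE0 : 0 < D + E + 1 by move: D0 E0; lra.
have r0 : 0 < r by rewrite invr_gt0.
have Dr : D * r < 1 by rewrite ltr_pdivrMr // mul1r; move: D0 E0; lra.
have Er : E * r < 1 by rewrite ltr_pdivrMr // mul1r; move: D0 E0; lra.
have aK_ulim (u : nat -> K) B : (forall k, aK (u k) <= B) ->
    exists x, forall eps, 0 < eps -> U [set k | aK (u k - x) < eps].
  exact: bounded_ulim.
have nrm_ulim (u : nat -> K) B : (forall k, crd_norm (u k) <= B) ->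
    exists x, forall eps, 0 < eps -> U [set k | crd_norm (u k - x) < eps].
  move=> uB; have [|x xP] := @aK_ulim u (E * B).
    by move=> k; apply: le_trans (aK_nrm _) _; rewrite ler_wpM2l ?(ltW E0).
  exists x => eps eps0.
  apply: (@filterS _ U _ _ _ _ (xP _ (divr_gt0 eps0 C0))) => k /=.
  rewrite ltr_pdivlMr // mulrC; exact: le_lt_trans.
have nonarchK n : aK n%:R <= 1.
  by rewrite -[n%:R](rmorph_nat (in_alg K)) aK_extends_aF.
have aK_unit x : unit_ball crd_norm r x -> aK x = 1.
  move=> xr; have x1 : aK (x - 1) < 1.
    by apply: le_lt_trans (aK_nrm _) _; apply: le_lt_trans Er; rewrite ler_wpM2l ?(ltW E0).
  apply/eqP; rewrite eq_le; apply/andP; split.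
    rewrite -[x](subrK 1); apply: le_trans (ultrametric_of_nat nonarchK _ _) _.
    by rewrite ge_max absval1 lexx (ltW x1).
  have := ultrametric_of_nat nonarchK x (1 - x).
  by rewrite addrC subrK absval1 absval_distC le_max [1 <= aK (_ - _)]leNgt x1 orbF.
have [c c0 c1] := absval_gt1 aF.
have tau_q x : iter t tau x = x by rewrite iter_tauE -qE sigma_q.
have nrm_tau x : crd_norm (tau x) <= crd_norm x.
  rewrite tauE; elim: s => //= k IH.
  exact: le_trans (crd_norm_sigma _) IH.
have t_gt0 : (0 < t)%N by move: q_gt0; rewrite qE muln_gt0 => /andP[].
have tau_c : tau c%:A = c%:A by rewrite linearZ /= rmorph1.
apply: (@norm_index R K crd_norm D r crd_norm0 crd_norm_ge0 crd_norm_eq0 crd_normB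
   nrmM D0 r0 Dr U UU Uoo nrm_ulim tau t block nrm_tau tau_q crd_norm_block
   block_sum aK c%:A C) => //.
- by rewrite scaler_eq0 negb_or c0 oner_neq0.
- by rewrite aK_extends_aF.
Qed.

End NormalBasisNorm.

(** * Cyclic Galois extensions *)

Lemma big_cycle (gT : finGroupType) (T : Type) (idx : T) (op : Monoid.com_law idx)
    (x : gT) (G : gT -> T) :
  \big[op/idx]_(g in <[x]>%g) G g = \big[op/idx]_(i < #[x]%g) G (x ^+ i)%g.
Proof.
have -> : <[x]>%g = [set (x ^+ i)%g | i : 'I_#[x]%g]%SET.
  apply/setP => g; apply/idP/imsetP => [/cyclePmin[i ix ->]|[i _ ->]].
    by exists (Ordinal ix).
  exact: mem_cycle.
rewrite big_imset //= => i j _ _ /eqP; rewrite eq_expg_mod_order !modn_small //.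
by move/eqP/val_inj.
Qed.

Section CyclicGalois.
Variables (F : fieldType) (K : splittingFieldType F) (sigma : gal_of {:K}).
Let s : {lrmorphism K -> K} := sigma.

Lemma gal_iter (tau : gal_of {:K}) i x : (tau ^+ i)%g x = iter i tau x.
Proof.
elim: i x => [|i IH] x; first by rewrite expg0 gal_id.
by rewrite expgS galM ?memvf // IH -iterSr.
Qed.

Lemma gal_iter_order (tau : gal_of {:K}) x : iter #[tau]%g tau x = x.
Proof. by rewrite -gal_iter expg_order gal_id. Qed.

Lemma galNorm_fixedField_cycle (tau : gal_of {:K}) x :
  galNorm (fixedField <[tau]>%g) {:K} x = iter_norm tau #[tau]%g x.
Proof.
rewrite /galNorm gal_fixedField big_cycle.
by apply: eq_bigr => i _; rewrite gal_iter.
Qed.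

Lemma cyclic_hilbert90 (tau : gal_of {:K}) x : iter_norm tau #[tau]%g x = 1 ->
  exists2 y, y != 0 & x = coboundary tau y.
Proof.
rewrite -galNorm_fixedField_cycle => /eqP Nx.
have gen : generator 'Gal({:K} / fixedField <[tau]>%g)%g tau.
  by rewrite /generator gal_fixedField.
have [y [_ y0] ->] := Hilbert's_theorem_90 gen (memvf x) Nx.
by exists y.
Qed.

(** By independence of automorphisms, no nonzero polynomial of degree below [q] annihilates [sigma],
    so [exists_cyclic_vector] applies. *)
Lemma gal_normal_basis : (#[sigma]%g)%:R != 0 :> F ->
  exists theta : K, forall c : 'I_#[sigma]%g -> F,
    \sum_i c i *: iter i sigma theta = 0 -> forall i, c i = 0.
Proof.
set q := #[sigma]%g => q0.
have [|f fq f_act|theta thetaP] := @exists_cyclic_vector F K s q q0.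
- exact: gal_iter_order.
- pose c_ (y : gal_of {:K}) : K := \sum_(i < q | (sigma ^+ i)%g == y) (f`_i)%:A.
  have c_E (i : 'I_q) : c_ (sigma ^+ i)%g = (f`_i)%:A.
    rewrite /c_ (big_pred1 i) // => j; rewrite eq_expg_mod_order !modn_small //.
  have c0 : forall y, y \in <[sigma]>%g -> c_ y = 0.
    apply: (@gal_independent _ _ _ (mem <[sigma]>%g)) => v _.
    rewrite big_cycle -[RHS](f_act v) (poly_act_wide _ _ fq).
    by apply: eq_bigr => i _; rewrite c_E gal_iter mulr_algl.
  apply/polyP => i; rewrite coef0; have [iq|qi] := ltnP i q; last first.
    by rewrite nth_default // (leq_trans fq).
  have := c0 _ (mem_cycle sigma i); rewrite (c_E (Ordinal iq)) => /eqP.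
  by rewrite scaler_eq0 oner_eq0 orbF => /eqP.
exists theta => c cP i.
pose f : {poly F} := rVpoly (\row_i c i).
have fq : (size f <= q)%N by exact: size_poly.
have /polyP/(_ i) : f = 0.
  apply: thetaP => //; rewrite (poly_act_wide _ _ fq) -[RHS]cP.
  by apply: eq_bigr => j _; rewrite coef_rVpoly_ord mxE.
by rewrite coef_rVpoly_ord mxE coef0.
Qed.

End CyclicGalois.

(** * Boundedness of linear maps and the archimedean obstruction *)

Section BoundedLinear.
Variables (R : realType) (F : fieldType) (K : fieldExtType F).
Variables (aF : absolute_value R F) (aK : absolute_value R K).
Hypothesis F_local : local_field aF.
Hypothesis aK_extends_aF : forall x : F, aK x%:A = aF x.

Lemma linear_bounded (f : {linear K -> K}) :
  exists2 C, 0 < C & forall x, aK (f x) <= C * aK x.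
Proof.
pose X := vbasis {:K}.
have X_free : free X by exact: basis_free (vbasisP _).
have [C C0 CP] := coord_bound F_local aK_extends_aF (e := fun i => X`_i) (freeP X_free).
pose E := \sum_(i < \dim {:K}) aK (f X`_i) + 1.
have E0 : 0 < E by rewrite ltr_wpDl // sumr_ge0 // => i _; rewrite absval_ge0.
exists (C * E) => [|x]; first exact: mulr_gt0.
pose c i := coord X i x.
have xE : x = \sum_i c i *: X`_i by exact: coord_basis (vbasisP _) (memvf x).
rewrite {1}xE linear_sum; apply: le_trans (absval_sum _ _ _ _) _.
rewrite -mulrA mulrCA mulrDl mul1r mulr_suml -[leLHS]addr0 lerD //; last first.
  by rewrite mulr_ge0 ?absval_ge0 // ltW.
apply: ler_sum => i _; rewrite linearZ /= (absvalZ aK_extends_aF) mulrC.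
by rewrite ler_wpM2l ?absval_ge0 //; have := CP c i; rewrite -xE.
Qed.

End BoundedLinear.

(** Dividing a Kummer generator by a fixed root gives [b] with [tau b = z * b] and [b ^+ p] equal to
    1 or -1. In the first case [b] is a power of [z], hence fixed by [tau], a contradiction; -1
    reduces to it for odd [p]. *)
Lemma arch_no_cyclic_p2 (R : realType) (F : fieldType) (K : splittingFieldType F)
    (aF : absolute_value R F) (aK : absolute_value R K) (sigma : gal_of {:K})
    (p n : nat) (xi : F) :
    prime p -> local_field aF -> local_field aK ->
    (forall x : F, aK x%:A = aF x) -> (exists m : nat, 1 < aF m%:R) ->
    #[sigma]%g = (p ^ n.+2)%N -> p.-primitive_root xi ->
  False.
Proof.
move=> p_pr F_local K_local ext [m m1] osigma xi_prim.
have p_gt0 := prime_gt0 p_pr; have p_gt1 := prime_gt1 p_pr.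
have [U [UU Uoo]] := exists_ultrafilter.
have arch : exists m : nat, 1 < aK m%:R.
  by exists m; rewrite -[m%:R](rmorph_nat (in_alg K)) ext.
pose tau := (sigma ^+ (p ^ n.+1))%g.
have otau : #[tau]%g = p.
  by rewrite orderXdiv osigma ?dvdn_exp2l // -expnB // subSn // subnn expn1.
pose z : K := xi%:A.
have fix_z (g : gal_of {:K}) : g z = z by rewrite /z linearZ /= rmorph1.
have z1 : z != 1.
  apply/eqP => z1; have /eqP : xi ^+ 1 = 1.
    by apply: (fmorph_inj (in_alg K)); rewrite /= expr1 scale1r.
  by rewrite -(prim_order_dvd xi_prim) dvdn1 gtn_eqF.
have z_prim : p.-primitive_root z by rewrite -[z]/(in_alg K xi) fmorph_primitive_root.
have zp : z ^+ p = 1 by exact: prim_expr_order.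
have z0 : z != 0.
  by apply/eqP => z0; move/eqP: zp; rewrite z0 expr0n gtn_eqF // eq_sym oner_eq0.
(* [coboundary] divides by the conjugate, so the inverse of [z] is what yields
   [tau alpha = z * alpha]. *)
have [|alpha al0 alE] := @cyclic_hilbert90 _ _ tau z^-1.
  by rewrite otau iter_normV (iter_norm_fixed _ (fix_z tau)) zp invr1.
have tal : tau alpha = z * alpha.
  have ta0 : tau alpha != 0 by rewrite fmorph_eq0.
  by rewrite -[z]invrK alE /coboundary invf_div divfK.
have [C C0 CP] := linear_bounded F_local ext tau.
have tap : tau (alpha ^+ p) = alpha ^+ p by rewrite rmorphXn /= tal exprMn zp mul1r.
have aK_ulim (u : nat -> K) B : (forall k, aK (u k) <= B) ->
    exists x, forall eps, 0 < eps -> U [set k | aK (u k - x) < eps].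
  exact: bounded_ulim.
have no_root b : tau b = z * b -> b ^+ p <> 1.
  move=> tb bp; have [k bE] := prim_rootP z_prim bp.
  have b0 : b != 0 by rewrite bE expf_neq0.
  have : tau b = b by rewrite bE rmorphXn /= fix_z.
  rewrite tb -[RHS]mul1r => /(mulIf b0) /eqP; exact/negP.
have quot y : y != 0 -> tau y = y -> tau (alpha / y) = z * (alpha / y).
  by move=> y0 ty; rewrite rmorphM fmorphV /= tal ty mulrA.
have ap0 : alpha ^+ p != 0 by rewrite expf_neq0.
have [|] := fixed_power_or_opp UU Uoo aK_ulim arch C0 CP p_gt0 ap0 tap.
  move=> [y [y0 ty yE]]; apply: (no_root _ (quot y y0 ty)).
  by rewrite expr_div_n yE divff // expf_neq0.
move=> [y [y0 ty yE]]; set b := alpha / y.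
have tb := quot y y0 ty; rewrite -/b in tb.
have bp : b ^+ p = -1.
  by rewrite expr_div_n -[alpha ^+ p]opprK yE mulNr divff // expf_neq0.
have [p2|p_odd] := even_prime p_pr; last first.
  apply: (no_root (- b)); first by rewrite rmorphN /= tb mulrN.
  by rewrite exprNn -signr_odd p_odd bp expr1 mulrNN mulr1.
(* For [p = 2], [b] is a square root of -1, so [sigma ^+ 2] fixes it; [tau] is a power of
   [sigma ^+ 2] because 4 divides the degree. *)
have sb2 : sigma b ^+ 2 = b ^+ 2 by rewrite -rmorphXn /= -p2 bp rmorphN1.
have ssb : sigma (sigma b) = b.
  have : (sigma b == b) || (sigma b == - b) by rewrite -eqf_sqr sb2.
  by case/orP => /eqP sbE; rewrite !sbE // rmorphN /= sbE opprK.
have b0 : b != 0 by rewrite mulf_neq0 ?invr_eq0.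
have : tau b = b.
  have s2b : (sigma ^+ 2)%g b = b by rewrite gal_iter.
  by rewrite /tau p2 expnS expgM gal_iter; exact: iter_fix s2b.
by rewrite tb -[RHS]mul1r => /(mulIf b0) /eqP; exact/negP.
Qed.

(** * The root of unity as a norm from K to the layer of degree p *)

Lemma root_of_unity_norm_group (R : realType) (p n : nat) (F : fieldType)
    (K : splittingFieldType F) (aF : absolute_value R F) (aK : absolute_value R K)
    (xi : F) :
    prime p -> local_field aF -> local_field aK ->
    (forall x : F, aK x%:A = aF x) ->
    galois 1%AS {:K}%AS -> cyclic 'Gal({:K}%AS / 1%AS)%g ->
    \dim {:K} = (p ^ n.+1)%N -> p \notin [pchar F] -> p.-primitive_root xi ->
  norm_group (intermediate_field K (p ^ 1)) xi%:A.
Proof.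
move=> p_pr F_local K_local ext K_gal K_cyc dimK pcharF xi_prim.
have p_gt0 := prime_gt0 p_pr.
have [sigma G_sigma] := cyclicP K_cyc.
have osigma : #[sigma]%g = (p ^ n.+1)%N.
  by rewrite orderE -G_sigma -(galois_dim K_gal) dimv1 divn1 dimK.
pose tau := (sigma ^+ p)%g.
have otau : #[tau]%g = (p ^ n)%N.
  by rewrite orderXdiv osigma ?expnS ?dvdn_mulr // mulKn.
have tauE x : tau x = iter p sigma x by rewrite gal_iter.
have dimM : \dim (fixedField <[tau]>%g) = (p ^ 1)%N.
  have := dim_fixedField <[tau]>%G; rewrite /= -orderE otau dimK => E.
  have dvdM : (\dim (fixedField <[tau]>%g) %| p ^ n.+1)%N.
    by rewrite -dimK; apply: (@field_dimS _ _ [aspace of fixedField <[tau]>%g] {:K}%AS); exact: subvf.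
  apply/eqP; rewrite -(eqn_pmul2l (_ : 0 < p ^ n)%N) ?expn_gt0 ?p_gt0 //.
  by rewrite {1}E divnK // -expnD addn1.
have <- : [aspace of fixedField <[tau]>%g] = intermediate_field K (p ^ 1).
  exact/(intermediate_fieldP (i := 1) _ p_pr K_gal K_cyc dimK isT).
suff [z z0 zE] : exists2 z : K, z != 0 & iter_norm tau (p ^ n) z = xi%:A.
  by exists z => //; rewrite -zE -otau -galNorm_fixedField_cycle.
have xiK : (xi%:A : K) ^+ p = 1.
  by rewrite -[xi%:A]/(in_alg K xi) -rmorphXn /= (prim_expr_order xi_prim) scale1r.
have sxi (g : gal_of {:K}) : g (xi%:A : K) = xi%:A by rewrite linearZ /= rmorph1.
have [arch|nonarch] := pselect (exists m : nat, 1 < aF m%:R).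
  (* In degree [p] the automorphism [tau] is trivial and [xi] is its own norm; archimedean fields
     allow no other degree. *)
  case: n dimK osigma otau {dimM} => [|n] dimK osigma otau.
    exists xi%:A; last by rewrite /iter_norm big_ord1.
    by apply/eqP => x0; move/eqP: xiK; rewrite x0 expr0n gtn_eqF // eq_sym oner_eq0.
  by case: (arch_no_cyclic_p2 p_pr F_local K_local ext arch osigma xi_prim).
have {}nonarch m : aF m%:R <= 1.
  by rewrite leNgt; apply/negP => m1; apply: nonarch; exists m.
have q_neq0 : (#[sigma]%g)%:R != 0 :> F.
  rewrite osigma natrX expf_neq0 //; apply: contra pcharF => /eqP p0.
  by rewrite inE p_pr p0 eqxx.
have [theta theta_free] := gal_normal_basis q_neq0.
have sigma_q := gal_iter_order sigma.
rewrite osigma in theta_free sigma_q.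
have q_gt0 : (0 < p ^ n.+1)%N by rewrite expn_gt0 p_gt0.
have hilb (g : gal_of {:K}) t : #[g]%g = t -> forall x : K, x != 0 ->
    iter_norm g t x = 1 -> exists2 y, y != 0 & x = coboundary g y.
  by move=> <- x _; exact: cyclic_hilbert90.
have index_of s t (g : gal_of {:K}) : (p ^ n.+1 = s * t)%N ->
    (forall x, g x = iter s sigma x) -> #[g]%g = t ->
    coset_index (kernel_of (coboundary g)) (iter_norm g t @` @nonzero K) t.
  move=> qE gE og.
  exact: (nonarch_norm_index F_local K_local ext nonarch dimK q_gt0 sigma_q
    theta_free qE gE (hilb g t og)).
apply: (root_of_unity_norm (sigma := sigma) p_pr tauE) xiK (sxi sigma).
- exact: hilb.
- by apply: (index_of 1%N); rewrite ?mul1n.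
- by apply: (index_of p); rewrite ?expnS.
Qed.

Theorem mainTheorem2
  (R : realType) (p n : nat) (F : fieldType) (K : splittingFieldType F)
  (aF : absolute_value R F) (aK : absolute_value R K) (xi : F)
  (p_prime : prime p) (n_ge1 : (1 <= n)%N)
  (F_local : local_field aF) (K_local : local_field aK)
  (aK_extends_aF : forall x : F, aK x%:A = aF x)
  (K_galois : galois 1%AS {:K}%AS)
  (K_cyclic : cyclic 'Gal({:K}%AS / 1%AS))
  (K_degree : \dim {:K} = (p ^ n)%N)
  (char_F : p \notin [pchar F])
  (xi_primitive : p.-primitive_root xi) :
  m_invariant K p n xi = -oo%E \/ m_invariant K p n xi = 0%:E.
Proof.
case: n n_ge1 K_degree => // n _ K_degree.
have norm1 := root_of_unity_norm_group p_prime F_local K_local aK_extends_aF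
  K_galois K_cyclic K_degree char_F xi_primitive.
(* The default [ord_max] of the minimum must satisfy the predicate for the minimum to be
   meaningful. *)
have normK : norm_group (intermediate_field K (p ^ n.+1)) xi%:A.
  have <- : {:K}%AS = intermediate_field K (p ^ n.+1).
    exact/(intermediate_fieldP _ p_prime K_galois K_cyclic K_degree (leqnn _)).
  have galKK : galois {:K}%AS {:K}%AS by apply: galoisS K_galois; rewrite sub1v subvv.
  have G1 : 'Gal({:K} / {:K})%g = 1%g.
    by apply: card1_trivg; rewrite -(galois_dim galKK) divnn adim_gt0.
  exists xi%:A; last by rewrite /galNorm G1 big_set1 gal_id.
  rewrite /= scaler_eq0 oner_eq0 orbF; apply/eqP => xi0.
  move: (prim_expr_order xi_primitive) => /eqP.
  by rewrite xi0 expr0n gtn_eqF ?prime_gt0 // eq_sym oner_eq0.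
rewrite /m_invariant; case: ifP => [_|/negbT not_norm0]; [by left|right].
case: arg_minnP => [|i Pi i_min]; first exact/asboolP.
suff -> : nat_of_ord i = 1%N by [].
apply/eqP; rewrite eqn_leq; apply/andP; split.
  have lt1 : (1 < n.+2)%N by [].
  by apply: (i_min (Ordinal lt1)); apply/asboolP.
rewrite lt0n; apply: contra not_norm0 => /eqP i0.
by have -> : ord0 = i by apply: val_inj; rewrite /= i0.
Qed.
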